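(* Let $G<\mathrm{Homeo}^+(\mathbf{R})$ be a coherent action of a finitely generated group such that there exists an element $g\in G$ with infinitely many components of support. Then the underlying group $G$ does not embed into Thompson's group $F$.
   Context: $\mathrm{Homeo}^+(\mathbf{R})$ is the group of orientation preserving homeomorphisms of $\mathbf{R}$. Actions are right actions, $x\mapsto x\cdot g$. A group action $G<\mathrm{Homeo}^+(\mathbf{R})$ means a subgroup of $\mathrm{Homeo}^+(\mathbf{R})$. The support of $g$ is the open set $\{x\in\mathbf{R}\mid x\cdot g\neq x\}$, and its components of support are the connected components of this set. An element has trivial germ at $+\infty$ (resp. $-\infty$) if it fixes each point of $(r,\infty)$ (resp. $(-\infty,r)$) for some $r\in\mathbf{R}$. The group of germs of $G$ at $+\infty$ (resp. $-\infty$) is the quotient of $G$ by the normal subgroup of elements with trivial germ at $+\infty$ (resp. $-\infty$). The action $G<\mathrm{Homeo}^+(\mathbf{R})$ is coherent if: (i) it is minimal, i.e. all orbits are dense in $\mathbf{R}$; (ii) the groups of germs at $+\infty$ and at $-\infty$ are solvable; (iii) there exists an element of $G$ that has trivial germ at $-\infty$ and does not fix any point in some interval $(r,\infty)$; (iv) there exists an element of $G$ that has trivial germ at $+\infty$ and does not fix any point in some interval $(-\infty,s)$. Thompson's group $F$ is the group of orientation preserving piecewise linear homeomorphisms of $[0,1]$ with finitely many breakpoints, all dyadic rationals, and whose derivatives, wherever they exist, are powers of $2$. ''Embeds'' means: there is an injective group homomorphism. *)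

(* Defs.v *)
From HB Require Import structures.
From mathcomp Require Import all_boot all_order all_algebra generic_quotient.
From mathcomp Require Import all_classical all_reals all_analysis.
From mathcomp Require Import ring.

Set Implicit Arguments.
Unset Strict Implicit.
Unset Printing Implicit Defensive.

Import Order.TTheory GRing.Theory Num.Theory.
Import numFieldNormedType.Exports.

Local Open Scope classical_set_scope.
Local Open Scope quotient_scope.
Local Open Scope group_scope.

Definition is_subgroup (gT : groupType) (H : set gT) : Prop :=
  [/\ H 1, forall x y, H x -> H y -> H (x * y) & forall x, H x -> H x^-1].

(** Through the coercion [set_type], a [subgroup] is itself used as a type; it
    is given the induced [groupType] structure below. *)
Record subgroup (gT : groupType) := Subgroup {
  subgroup_set :> set gT;
  subgroupP : is_subgroup subgroup_set }.

Section SubgroupGroup.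
Context (gT : groupType) (H : subgroup gT).

Lemma subgroup_group_closed :
  group_closed (fun x : gT => x \in (subgroup_set H)).
Proof.
case: (subgroupP H) => H1 HM HV; split; first exact/mem_set.
by move=> x y /set_mem Hx /set_mem Hy; apply/mem_set; apply: HM => //; apply: HV.
Qed.

HB.instance Definition _ := SubChoice.copy (set_type (subgroup_set H))
  {x : gT | x \in subgroup_set H}.
HB.instance Definition _ := SubChoice_isSubGroup.Build gT _
  (set_type (subgroup_set H)) subgroup_group_closed.

End SubgroupGroup.

Record normal_subgroup (gT : groupType) := NormalSubgroup {
  normal_subgroup_subgroup :> subgroup gT;
  normal_subgroupP : forall x y : gT,
    (normal_subgroup_subgroup : set gT) x ->
    (normal_subgroup_subgroup : set gT) (x ^ y) }.

Section Quotient.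
Context (gT : groupType) (N : normal_subgroup gT).
Implicit Types x y z : gT.

Let NN : set gT := N.

Definition coset_eq : rel gT := fun x y => `[< NN (x * y^-1) >].

Let N1 : NN 1. Proof. by case: (subgroupP N). Qed.
Let NM x y : NN x -> NN y -> NN (x * y).
Proof. by case: (subgroupP N) => _ + _; apply. Qed.
Let NV x : NN x -> NN x^-1.
Proof. by case: (subgroupP N) => _ _; apply. Qed.
Let NJ x y : NN x -> NN (x ^ y). Proof. exact: normal_subgroupP. Qed.

Lemma coset_eq_refl : reflexive coset_eq.
Proof. by move=> x; apply/asboolP; rewrite mulgV. Qed.

Lemma coset_eq_sym : symmetric coset_eq.
Proof.
move=> x y; apply/asboolP/asboolP => /NV; by rewrite invgM invgK.
Qed.

Lemma coset_eq_trans : transitive coset_eq.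
Proof.
move=> y x z /asboolP xy /asboolP yz; apply/asboolP.
by have := NM xy yz; rewrite mulgA mulgVK.
Qed.

Canonical coset_eq_equiv : equiv_rel gT :=
  EquivRel coset_eq coset_eq_refl coset_eq_sym coset_eq_trans.

Definition quotient_group := {eq_quot coset_eq}.
HB.instance Definition _ := Choice.on quotient_group.
HB.instance Definition _ := EqQuotient.on quotient_group.

Definition quotient_mul (u v : quotient_group) : quotient_group :=
  \pi_quotient_group (repr u * repr v).
Definition quotient_one : quotient_group := \pi_quotient_group 1.
Definition quotient_inv (u : quotient_group) : quotient_group :=
  \pi_quotient_group (repr u)^-1.

Lemma coset_eqP x y :
  reflect (\pi_quotient_group x = \pi_quotient_group y) `[< NN (x * y^-1) >].
Proof. exact: (@eqmodP _ coset_eq_equiv). Qed.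

Lemma coset_repr x : NN (repr (\pi_quotient_group x) * x^-1).
Proof. by apply/asboolP/coset_eqP; rewrite reprK. Qed.

Lemma quotient_mulE x y :
  quotient_mul (\pi_quotient_group x) (\pi_quotient_group y) =
  \pi_quotient_group (x * y).
Proof.
apply/coset_eqP/asboolP.
have := NM (coset_repr x) (NJ x^-1 (coset_repr y)).
by rewrite /conjg invgK invgM !mulgA mulgVK.
Qed.

Lemma quotient_invE x :
  quotient_inv (\pi_quotient_group x) = \pi_quotient_group x^-1.
Proof.
apply/coset_eqP/asboolP; rewrite invgK.
have := NJ x (NV (coset_repr x)).
by rewrite /conjg invgM invgK !mulgA mulVg mul1g.
Qed.

Lemma quotient_groupW (P : quotient_group -> Prop) :
  (forall x, P (\pi_quotient_group x)) -> forall u, P u.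
Proof. by move=> Ppi u; rewrite -[u]reprK. Qed.

Lemma quotient_mulA : associative quotient_mul.
Proof.
by elim/quotient_groupW=> x; elim/quotient_groupW=> y; elim/quotient_groupW=> z; rewrite !quotient_mulE mulgA.
Qed.
Lemma quotient_mul1 : left_id quotient_one quotient_mul.
Proof. by elim/quotient_groupW=> x; rewrite quotient_mulE mul1g. Qed.
Lemma quotient_mulr1 : right_id quotient_one quotient_mul.
Proof. by elim/quotient_groupW=> x; rewrite quotient_mulE mulg1. Qed.
Lemma quotient_mulV : left_inverse quotient_one quotient_inv quotient_mul.
Proof. by elim/quotient_groupW=> x; rewrite quotient_invE quotient_mulE mulVg. Qed.
Lemma quotient_mulrV : right_inverse quotient_one quotient_inv quotient_mul.
Proof. by elim/quotient_groupW=> x; rewrite quotient_invE quotient_mulE mulgV. Qed.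

HB.instance Definition _ := isGroup.Build quotient_group
  quotient_mulA quotient_mul1 quotient_mulr1 quotient_mulV quotient_mulrV.

End Quotient.

Definition generated (gT : groupType) (A : set gT) : set gT :=
  smallest (@is_subgroup gT) A.

Definition finitely_generated (gT : groupType) : Prop :=
  exists A : set gT, finite_set A /\ generated A = setT.

Fixpoint derived_series {gT : groupType} (n : nat) : set gT :=
  if n is m.+1 then
    generated [set z | exists x y, [/\ derived_series m x,
                                       derived_series m y & z = [~ x, y]]]
  else setT.

Definition solvable (gT : groupType) : Prop :=
  exists n, @derived_series gT n = [set 1].

Definition embeds (gT hT : groupType) : Prop :=
  exists f : {multiplicative gT -> hT}, injective f.

Record homeo (T : topologicalType) := Homeo {
  homeo_fun :> T -> T;
  homeo_inv : T -> T;
  homeo_funK : cancel homeo_fun homeo_inv;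
  homeo_invK : cancel homeo_inv homeo_fun;
  homeo_cont : continuous homeo_fun;
  homeo_inv_cont : continuous homeo_inv }.

HB.instance Definition _ (T : topologicalType) := gen_eqMixin (homeo T).
HB.instance Definition _ (T : topologicalType) := gen_choiceMixin (homeo T).

Section HomeoGroup.
Context {T : topologicalType}.
Implicit Types f g h : homeo T.

Lemma homeo_eq f g : f =1 g -> f = g.
Proof.
case: f g => [f f' fK f'K cf cf'] [g g' gK g'K cg cg'] /= fg.
have E : f = g by apply: funext.
subst g.
have E' : f' = g' by apply: funext => x; rewrite -{1}(g'K x) fK.
subst g'.
by rewrite (Prop_irrelevance fK gK) (Prop_irrelevance f'K g'K)
           (Prop_irrelevance cf cg) (Prop_irrelevance cf' cg').
Qed.

Definition homeo_one : homeo T.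
Proof. by exists idfun idfun => // x; exact: cvg_id. Defined.

(** Right actions: [f * g] applies [f] first. *)
Definition homeo_mul f g : homeo T.
Proof.
exists (g \o f) (homeo_inv f \o homeo_inv g).
- exact: can_comp (homeo_funK g) (homeo_funK f).
- exact: can_comp (homeo_invK f) (homeo_invK g).
- by move=> x; apply: continuous_comp; apply: homeo_cont.
- by move=> x; apply: continuous_comp; apply: homeo_inv_cont.
Defined.

Definition homeo_opp f : homeo T :=
  Homeo (homeo_invK f) (homeo_funK f) (homeo_inv_cont (h := f))
        (homeo_cont (h := f)).

Lemma homeo_mulA : associative homeo_mul.
Proof. by move=> f g h; apply: homeo_eq. Qed.
Lemma homeo_mul1 : left_id homeo_one homeo_mul.
Proof. by move=> f; apply: homeo_eq. Qed.
Lemma homeo_mulr1 : right_id homeo_one homeo_mul.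
Proof. by move=> f; apply: homeo_eq. Qed.
Lemma homeo_mulV : left_inverse homeo_one homeo_opp homeo_mul.
Proof. by move=> f; apply: homeo_eq => x; exact: homeo_invK. Qed.
Lemma homeo_mulrV : right_inverse homeo_one homeo_opp homeo_mul.
Proof. by move=> f; apply: homeo_eq => x; exact: homeo_funK. Qed.

HB.instance Definition _ := isGroup.Build (homeo T)
  homeo_mulA homeo_mul1 homeo_mulr1 homeo_mulV homeo_mulrV.

End HomeoGroup.

Section Line.
Context (R : realType).

Definition increasing_homeo : set (homeo R) :=
  [set f : homeo R | {homo f : x y / (x < y)%R}].

Lemma increasing_homeo_subgroup : is_subgroup increasing_homeo.
Proof.
split=> [x y //|f g fi gi x y xy|f fi x y xy]; first exact/gi/fi.
case: (ltP (f^-1 x) (f^-1 y)) => // yx.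
have {yx} : (y <= x)%R.
  rewrite -(homeo_invK f y) -(homeo_invK f x).
  by have := ltW_homo fi yx.
by rewrite leNgt xy.
Qed.

Definition HomeoPlus : subgroup (homeo R) := Subgroup increasing_homeo_subgroup.

Definition act (x : R) (g : HomeoPlus) : R := (val g : homeo R) x.

End Line.

Notation "x ⋅ g" := (act x g) (at level 40, left associativity).

Section Germs.
Context (R : realType).
Implicit Types (G : subgroup (HomeoPlus R)) (x y r : R).

Lemma actM x (g h : HomeoPlus R) : x ⋅ (g * h) = x ⋅ g ⋅ h.
Proof. by []. Qed.

Lemma act1 x : x ⋅ 1 = x.
Proof. by []. Qed.

Lemma actK (g : HomeoPlus R) x : x ⋅ g ⋅ g^-1 = x.
Proof. by rewrite -actM mulgV. Qed.

Lemma actVK (g : HomeoPlus R) x : x ⋅ g^-1 ⋅ g = x.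
Proof. by rewrite -actM mulVg. Qed.

Lemma act_lt (g : HomeoPlus R) x y : (x < y)%R -> (x ⋅ g < y ⋅ g)%R.
Proof. by case: g => g gi; move: (set_mem gi); apply. Qed.

Definition support (g : HomeoPlus R) : set R := [set x | x ⋅ g != x].

Definition components_of_support (g : HomeoPlus R) : set (set R) :=
  [set connected_component (support g) x | x in support g].

Definition trivial_germ_pinfty (g : HomeoPlus R) : Prop :=
  exists r, forall x, (r < x)%R -> x ⋅ g = x.

Definition trivial_germ_ninfty (g : HomeoPlus R) : Prop :=
  exists r, forall x, (x < r)%R -> x ⋅ g = x.

Definition germ_kernel_pinfty_set G : set G :=
  [set g | trivial_germ_pinfty (val g)].

Definition germ_kernel_ninfty_set G : set G :=
  [set g | trivial_germ_ninfty (val g)].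

Lemma germ_kernel_pinfty_subgroup G : is_subgroup (@germ_kernel_pinfty_set G).
Proof.
split=> [|g h [r gr] [s hs]|g [r gr]].
- by exists 0%R.
- exists (Num.max r s) => x; rewrite gt_max => /andP[rx sx].
  by rewrite actM gr // hs.
- by exists r => x rx; rewrite -{1}(gr _ rx) actK.
Qed.

Lemma germ_kernel_ninfty_subgroup G : is_subgroup (@germ_kernel_ninfty_set G).
Proof.
split=> [|g h [r gr] [s hs]|g [r gr]].
- by exists 0%R.
- exists (Num.min r s) => x; rewrite lt_min => /andP[rx sx].
  by rewrite actM gr // hs.
- by exists r => x rx; rewrite -{1}(gr _ rx) actK.
Qed.

Lemma germ_kernel_pinfty_normal G (g h : G) :
  germ_kernel_pinfty_set g -> germ_kernel_pinfty_set (g ^ h).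
Proof.
move=> [r gr]; exists (r ⋅ val h) => x rx.
rewrite /conjg 2!actM gr ?actVK //.
by have := act_lt (val h)^-1 rx; rewrite actK.
Qed.

Lemma germ_kernel_ninfty_normal G (g h : G) :
  germ_kernel_ninfty_set g -> germ_kernel_ninfty_set (g ^ h).
Proof.
move=> [r gr]; exists (r ⋅ val h) => x rx.
rewrite /conjg 2!actM gr ?actVK //.
by have := act_lt (val h)^-1 rx; rewrite actK.
Qed.

Definition germ_kernel_pinfty G : normal_subgroup G :=
  @NormalSubgroup G (Subgroup (@germ_kernel_pinfty_subgroup G))
    (@germ_kernel_pinfty_normal G).

Definition germ_kernel_ninfty G : normal_subgroup G :=
  @NormalSubgroup G (Subgroup (@germ_kernel_ninfty_subgroup G))
    (@germ_kernel_ninfty_normal G).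

Definition germs_pinfty G : groupType := quotient_group (germ_kernel_pinfty G).
Definition germs_ninfty G : groupType := quotient_group (germ_kernel_ninfty G).

Definition minimal_action G : Prop :=
  forall x, dense [set x ⋅ val g | g in [set: G]].

Definition coherent G : Prop :=
  [/\ minimal_action G,
      solvable (germs_pinfty G) /\ solvable (germs_ninfty G),
      exists g : G, trivial_germ_ninfty (val g) /\
        exists r, forall x, (r < x)%R -> x ⋅ val g != x
    & exists g : G, trivial_germ_pinfty (val g) /\
        exists s, forall x, (x < s)%R -> x ⋅ val g != x].

End Germs.

Section Thompson.
Context (R : realType).
Local Open Scope ring_scope.

Definition unit_interval : Type := set_type (`[0, 1]%classic : set R).
HB.instance Definition _ := Topological.on unit_interval.
HB.instance Definition _ :=
  SubChoice.copy unit_interval {x : R | x \in (`[0, 1]%classic : set R)}.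

Definition dyadic (x : R) : Prop :=
  exists (m : int) (k : nat), x = m%:~R / 2 ^+ k.

Definition affine_pow2_on (f : homeo unit_interval) (x y : unit_interval) :=
  exists (k : int) (b : R), forall z : unit_interval,
    val x <= val z <= val y -> val (f z) = 2 ^ k * val z + b.

(** The sequence [s] lists finitely many dyadic numbers containing all
    breakpoints: [f] is affine, with slope a power of 2, on every interval
    having no element of [s] in its interior. *)
Definition dyadic_pl (f : homeo unit_interval) : Prop :=
  exists s : seq R,
    {in s, forall a, dyadic a} /\
    forall x y : unit_interval, val x < val y ->
      {in s, forall a, ~~ (val x < a < val y)} -> affine_pow2_on f x y.

Lemma dyadicD (x y : R) : dyadic x -> dyadic y -> dyadic (x + y).
Proof.
move=> [m [k ->]] [n [l ->]]; exists (m * 2 ^+ l + n * 2 ^+ k), (k + l)%N.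
have h (i : nat) : (2 ^+ i : R) != 0 by rewrite expf_neq0 // pnatr_eq0.
by rewrite rmorphD !rmorphM !rmorphXn /= exprD; field; rewrite !h.
Qed.

Lemma dyadicN (x : R) : dyadic x -> dyadic (- x).
Proof. by move=> [m [k ->]]; exists (- m), k; rewrite rmorphN mulNr. Qed.

Lemma dyadicM2 (k : int) (x : R) : dyadic x -> dyadic (2 ^ k * x).
Proof.
move=> [m [l ->]]; case: k => k.
  exists (2 ^+ k * m), l; rewrite rmorphM rmorphXn /= mulrA.
  by rewrite -exprnP.
exists m, (k.+1 + l)%N.
by rewrite NegzE -exprnN exprD invfM mulrCA.
Qed.

Lemma unit_interval_bounds (x : unit_interval) : 0 <= val x <= 1.
Proof. by case: x => x xI /=; move: (set_mem xI); rewrite /= in_itv. Qed.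

Definition mk_unit_interval (x : R) (h : 0 <= x <= 1) : unit_interval.
Proof. by exists x; apply/mem_set; rewrite /= in_itv. Defined.

Lemma val_unit_interval_inj (x y : unit_interval) : val x = val y -> x = y.
Proof. exact: val_inj. Qed.

Section PL.
Implicit Types f g : homeo unit_interval.

Definition increasing f := {homo f : x y / val x < val y}.

Lemma increasing_le f : increasing f -> {homo f : x y / val x <= val y}.
Proof.
move=> fi x y; rewrite le_eqVlt => /orP[/eqP/val_unit_interval_inj -> //|].
by move=> /fi /ltW.
Qed.

Lemma increasing_lt f : increasing f ->
  forall x y, (val (f x) < val (f y)) = (val x < val y).
Proof.
move=> fi x y; apply/idP/idP; last exact: fi.
by rewrite !ltNge; apply: contra; exact: increasing_le.
Qed.

Lemma increasingV f : increasing f -> increasing (f^-1)%g.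
Proof.
by move=> fi x y xy; rewrite -(increasing_lt fi) !homeo_invK.
Qed.

Lemma increasing0 f x : increasing f -> val x = 0 -> val (f x) = 0.
Proof.
move=> fi x0; have h : 0 <= (0 : R) <= 1 by rewrite lexx ler01.
pose o := mk_unit_interval h.
have : val (f x) <= val (f (homeo_inv f o)).
  apply: increasing_le => //; rewrite x0.
  by case/andP: (unit_interval_bounds (homeo_inv f o)).
rewrite homeo_invK /= => fx0; apply/eqP; rewrite eq_le fx0.
by case/andP: (unit_interval_bounds (f x)).
Qed.

Lemma count_lt (T : eqType) (P Q : pred T) (s : seq T) a :
  subpred P Q -> a \in s -> Q a -> ~~ P a -> (count P s < count Q s)%N.
Proof.
move=> PQ + Qa Pa; elim: s => //= z s IH; rewrite inE => /orP[/eqP <-|/IH h].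
  by rewrite Qa (negbTE Pa) add0n add1n ltnS; exact: sub_count.
rewrite -addnS leq_add //.
by case Pz: (P z) => //; rewrite (PQ _ Pz).
Qed.

Lemma dyadic_pl_sub f x y : dyadic_pl f -> val x < val y ->
  dyadic (val x) -> dyadic (val y) -> dyadic (val (f y) - val (f x)).
Proof.
move=> [s [sd sf]].
move: {2}(count _ s).+1 (ltnSn (count (fun a => val x < a < val y) s)).
move=> n; elim: n x y => // n IH x y; rewrite ltnS => cn xy dx dy.
have [/hasP[a sa /andP[xa ay]]|/hasPn nh] :=
    boolP (has (fun a => val x < a < val y) s); last first.
  have [|k [b kb]] := sf x y xy; first by move=> a /nh.
  rewrite !kb ?lexx ?(ltW xy) //.
  have -> : 2 ^ k * val y + b - (2 ^ k * val x + b) = 2 ^ k * (val y - val x).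
    by ring.
  by apply: dyadicM2; apply: dyadicD => //; apply: dyadicN.
have h : 0 <= a <= 1.
  case/andP: (unit_interval_bounds x) => x0 _.
  case/andP: (unit_interval_bounds y) => _ y1.
  by rewrite (ltW (le_lt_trans x0 xa)) (ltW (lt_le_trans ay y1)).
pose c := mk_unit_interval h.
have da : dyadic (val c) by exact: sd.
have -> : val (f y) - val (f x) =
  (val (f y) - val (f c)) + (val (f c) - val (f x)) by ring.
apply: dyadicD; apply: IH => //; apply: leq_trans cn.
  apply: (count_lt (a := a)) => //; rewrite ?xa ?ay ?ltxx //.
  by move=> z /= /andP[az ->]; rewrite (lt_trans xa az).
apply: (count_lt (a := a)) => //; rewrite ?xa ?ay ?ltxx ?andbF //.
by move=> z /= /andP[-> az]; rewrite (lt_trans az ay).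
Qed.

Lemma dyadic_pl_dyadic f x : increasing f -> dyadic_pl f ->
  dyadic (val x) -> dyadic (val (f x)).
Proof.
move=> fi fpl dx; have h : 0 <= (0 : R) <= 1 by rewrite lexx ler01.
have d0 : dyadic (0 : R) by exists 0, 0%N; rewrite mul0r.
have [/eqP x0|x0] := boolP (val x == 0); first by rewrite increasing0.
pose o := mk_unit_interval h.
have ox : val o < val x.
  by rewrite lt_neqAle eq_sym x0; case/andP: (unit_interval_bounds x).
have := dyadic_pl_sub fpl ox d0 dx.
by rewrite (@increasing0 f o) // subr0.
Qed.

(** Action on real numbers, extended by 0 outside of [0, 1]. *)
Let ext f (a : R) : R :=
  if (insub a : option unit_interval) is Some c then val (f c) else 0.

Let extE f c : ext f (val c) = val (f c).
Proof. by rewrite /ext valK. Qed.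

Let ext_dyadic f s : increasing f -> dyadic_pl f ->
  {in s, forall a, dyadic a} -> {in map (ext f) s, forall a, dyadic a}.
Proof.
move=> fi fpl sd _ /mapP[a /sd da ->]; rewrite /ext; case: insubP => [c _ ca|_].
  by apply: dyadic_pl_dyadic => //; rewrite ca.
by exists 0, 0%N; rewrite mul0r.
Qed.

Let ext_between f s x y : increasing f ->
  {in map (ext f) s, forall a, ~~ (val (f x) < a < val (f y))} ->
  {in s, forall a, ~~ (val x < a < val y)}.
Proof.
move=> fi H a sa; apply/negP => /andP[xa ay].
have h : 0 <= a <= 1.
  case/andP: (unit_interval_bounds x) => x0 _.
  case/andP: (unit_interval_bounds y) => _ y1.
  by rewrite (ltW (le_lt_trans x0 xa)) (ltW (lt_le_trans ay y1)).
have /negP := H _ (map_f (ext f) sa); apply.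
by rewrite (extE f (mk_unit_interval h)) !(increasing_lt fi) xa ay.
Qed.

Lemma dyadic_plV f : increasing f -> dyadic_pl f -> dyadic_pl (f^-1)%g.
Proof.
move=> fi fpl; have [s [sd sf]] := fpl.
exists (map (ext f) s); split; first exact: ext_dyadic.
move=> x y xy H; have [||k [b kb]] := sf ((f^-1)%g x) ((f^-1)%g y).
- by apply: increasingV.
- by apply: (ext_between fi); rewrite !homeo_invK.
exists (- k), (- (2 ^ (- k) * b)) => z /andP[xz zy].
have := kb ((f^-1)%g z); rewrite homeo_invK => ->.
  rewrite mulrDr mulrA -expfzDr ?pnatr_eq0 // addNr expr0z mul1r.
  by rewrite addrK.
by rewrite !(increasing_le (increasingV fi)).
Qed.

Lemma dyadic_plM f g : increasing f -> dyadic_pl f -> dyadic_pl g ->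
  dyadic_pl (f * g)%g.
Proof.
move=> fi fpl [t [td tg]]; have [s [sd sf]] := fpl.
exists (s ++ map (ext (f^-1)%g) t); split.
  move=> a; rewrite mem_cat => /orP[/sd //|].
  by apply: ext_dyadic => //; [exact: increasingV | exact: dyadic_plV].
move=> x y xy H.
have [|k [b kb]] := sf x y xy.
  by move=> a sa; apply: H; rewrite mem_cat sa.
have [||l [c lc]] := tg (f x) (f y); first exact: fi.
  apply: (ext_between (increasingV fi)) => a ta.
  rewrite [(f^-1)%g (f x)]homeo_funK [(f^-1)%g (f y)]homeo_funK.
  by apply: H; rewrite mem_cat ta orbT.
exists (l + k), (2 ^ l * b + c) => z xzy; have /andP[xz zy] := xzy.
have -> : (f * g)%g z = g (f z) by [].
rewrite lc ?(increasing_le fi) // kb // expfzDr ?pnatr_eq0 //; ring.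
Qed.

End PL.

Definition thompson_set : set (homeo unit_interval) :=
  [set f : homeo unit_interval | {homo f : x y / val x < val y} /\ dyadic_pl f].

Lemma thompson_subgroup : is_subgroup thompson_set.
Proof.
split=> [|f g [fi fpl] [gi gpl]|f [fi fpl]].
- split=> //; exists [::]; split=> // x y xy _; exists 0, 0 => z _.
  by rewrite expr0z mul1r addr0.
- by split; [move=> x y /fi /gi | exact: dyadic_plM].
- by split; [exact: increasingV | exact: dyadic_plV].
Qed.

Definition ThompsonF : subgroup (homeo unit_interval) :=
  Subgroup thompson_subgroup.

End Thompson.

(* Main.v *)
Require Import Defs.
From mathcomp Require Import all_boot all_order all_algebra.
From mathcomp Require Import all_classical all_reals all_analysis.
From mathcomp Require Import lra ring.

Set Implicit Arguments.
Unset Strict Implicit.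
Unset Printing Implicit Defensive.

Import Order.TTheory GRing.Theory Num.Theory.
Import numFieldNormedType.Exports.

Local Open Scope classical_set_scope.
Local Open Scope ring_scope.

(** A coherent action is compared with the action on the line given by an
    embedding into Thompson's group, where elements of F are extended by the
    identity outside the unit interval. The contradiction comes from the fact
    that each element of F has finitely many components of support, which is
    [finite_bumps]. The rest of the argument is about order-preserving
    bijections of the line, so both actions are instances of [order_action].

    In the coherent action, a map that is trivial near -oo and pushes a
    neighbourhood of +oo to +oo, together with minimality, compresses any
    segment into any interval, and even positions two segments independently
    ([contract_pair]). Commutators of such maps with those trivial near +oo
    give nontrivial elements of bounded support. Hence for a component C of the
    support of g the group H_C of elements supported in a compact part of C is
    large: it pushes segments of C into any interval on their left ([push_into]),
    its commutators do not all commute with g ([noncentral_commutator]), and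
    any subgroup normalised by H_C that displaces small segments arbitrarily
    close to the left end of C contains all commutators of H_C
    ([commutators_in_normal]).

    In the second action, call block of a group the components of the
    complement of its global fixed points. When H and K commute, finiteness of
    supports forces K to preserve each block of H, and forces an element of K
    with a fixed point in a block to be trivial on that block. So K acts on a
    block freely modulo a kernel, and by Hoelder's theorem commutators of K are
    trivial there: the support of H misses the support of every commutator of
    K ([commuting_supports]).

    Now let g have infinitely many components C_n in the coherent action. For
    each n choose v_n that is moved, in the second action, both by g and by a
    commutator of H_(C_n). Since g has finitely many components of support
    there, two of these points, v_i and v_j, lie in the same one. Let H and K
    be the groups of C_i and C_j; they commute, so H fixes v_j. Let E be the
    block of H containing v_i. If E were g-invariant, powers of g would carry
    v_i past v_j inside E, which is absurd. If E is moved by g, all the E.g^n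
    are distinct, so each h in H is trivial on almost all of them, that is,
    the conjugates of h by g^n act trivially on E for large n. But in the
    coherent action these conjugates displace segments close to an end of C_i,
    so the kernel of H on E contains the commutators of H, one of which moves
    v_i: again absurd. *)

(** * Order-preserving actions on the line *)

Record order_action (R : realType) (gT : groupType) := OrderAction {
  order_action_fun :> gT -> R -> R;
  order_actionM : forall g h x,
    order_action_fun (g * h)%g x = order_action_fun h (order_action_fun g x);
  order_action1 : forall x, order_action_fun 1%g x = x;
  order_action_homo : forall g, {homo order_action_fun g : x y / x < y} }.

Definition faithful (R : realType) (gT : groupType) (a : order_action R gT) :=
  forall g, (forall x, a g x = x) -> g = 1%g.

(** The order of the end points is left open because the points that have to
    be compared are produced without control on their relative position. *)
Definition between (R : realType) (x p y : R) := (x <= p <= y) || (y <= p <= x).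

Section Basics.
Context (R : realType) (gT : groupType) (a : order_action R gT).
Implicit Types (x y p : R) (g h : gT) (S H : set gT).

Local Notation "x ∙ g" := (a g x) (at level 40, left associativity).

Lemma oactM x g h : x ∙ (g * h)%g = x ∙ g ∙ h.
Proof. exact: order_actionM. Qed.

Lemma oact1 x : x ∙ 1%g = x.
Proof. exact: order_action1. Qed.

Lemma oactK g x : x ∙ g ∙ g^-1%g = x.
Proof. by rewrite -oactM mulgV oact1. Qed.

Lemma oactVK g x : x ∙ g^-1%g ∙ g = x.
Proof. by rewrite -oactM mulVg oact1. Qed.

Lemma oact_lt g x y : (x ∙ g < y ∙ g) = (x < y).
Proof.
apply/idP/idP; last exact: order_action_homo.
by move=> /(order_action_homo a g^-1%g); rewrite !oactK.
Qed.

Lemma oact_le g x y : (x ∙ g <= y ∙ g) = (x <= y).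
Proof. by rewrite !leNgt oact_lt. Qed.

Lemma oact_inj g : injective (a g).
Proof. exact: can_inj (oactK g). Qed.

Lemma oact_ltV g x y : (x < y ∙ g) = (x ∙ g^-1%g < y).
Proof. by rewrite -[RHS](oact_lt g) oactVK. Qed.

Lemma oact_leV g x y : (x <= y ∙ g) = (x ∙ g^-1%g <= y).
Proof. by rewrite -[RHS](oact_le g) oactVK. Qed.

Lemma oact_fixV g x : x ∙ g = x -> x ∙ g^-1%g = x.
Proof. by move=> xg; rewrite -{1}xg oactK. Qed.

Lemma oactXS g n x : x ∙ (g ^+ n.+1)%g = x ∙ (g ^+ n)%g ∙ g.
Proof. by rewrite expgSr oactM. Qed.

Lemma oact_fixX g n x : x ∙ g = x -> x ∙ (g ^+ n)%g = x.
Proof. by move=> xg; elim: n => [|n IH]; rewrite ?expg0 ?oact1 // oactXS IH. Qed.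

Lemma oactJ g h x : x ∙ h ∙ (g ^ h)%g = x ∙ g ∙ h.
Proof. by rewrite -!oactM -conjgC. Qed.

Lemma faithful_eq g h : faithful a -> (forall x, x ∙ g = x ∙ h) -> g = h.
Proof.
move=> fa gh; apply/eqP; rewrite -divg_eq1; apply/eqP/fa => x.
by rewrite oactM gh oactK.
Qed.

Lemma oactX_homo g x m n : x <= x ∙ g -> (m <= n)%N ->
  x ∙ (g ^+ m)%g <= x ∙ (g ^+ n)%g.
Proof.
move=> xg mn; rewrite -(subnKC mn) addnC expgnDr oactM oact_le.
elim: (n - m)%N => [|k IH]; first by rewrite expg0 oact1.
by rewrite oactXS (le_trans xg) // oact_le.
Qed.

Definition fixed S x := forall s, S s -> x ∙ s = x.

(** For points not fixed by [S], linked points are those in the same component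
    of the complement of the common fixed points of [S]; for [S] a singleton
    this is a component of the support of an element. *)
Definition linked S x y := forall p, between x p y -> ~ fixed S p.

Lemma linked1P g x y :
  linked [set g] x y <-> (forall p, between x p y -> p ∙ g <> p).
Proof.
by split=> xy p /xy np; [move=> pg; apply: np => s -> | move=> /(_ g erefl)].
Qed.

Lemma linked_sym S x y : linked S x y -> linked S y x.
Proof. by move=> xy p; rewrite /between orbC; apply: xy. Qed.

Lemma linked_sub S x y z : between x y z -> linked S x z -> linked S x y.
Proof.
by move=> xyz xz p xpy; apply: xz; move: xyz xpy; rewrite /between; lra.
Qed.

Lemma linked_trans S x y z : linked S x y -> linked S y z -> linked S x z.
Proof.
move=> xy yz p xpz.
have [?|?] : between x p y \/ between y p z by move: xpz; rewrite /between; lra.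
  exact: xy.
exact: yz.
Qed.

Lemma linked_nfixed S x y : linked S x y -> ~ fixed S x.
Proof. by apply; rewrite /between lexx; lra. Qed.

Lemma linked_refl S x : ~ fixed S x -> linked S x x.
Proof. by move=> nx p xpx; have -> : p = x by move: xpx; rewrite /between; lra. Qed.

Lemma not_linked S x y : ~ linked S x y -> exists2 p, between x p y & fixed S p.
Proof.
by move=> nl; apply: contrapT => np; apply: nl => p xpy pS; apply: np; exists p.
Qed.

Lemma fixed_act S g x : (forall s, S s -> S (s ^ g^-1)%g) ->
  fixed S x -> fixed S (x ∙ g).
Proof.
move=> Sg xS s /Sg /xS xs.
by rewrite -{1}[s](conjgKV g) oactJ xs.
Qed.

Lemma between_act x p y g : between (x ∙ g) (p ∙ g) (y ∙ g) = between x p y.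
Proof. by rewrite /between !oact_le. Qed.

Lemma linked_act S g x y : (forall s, S s -> S (s ^ g)%g) ->
  linked S x y -> linked S (x ∙ g) (y ∙ g).
Proof.
move=> Sg xy p; rewrite -(oactVK g p) between_act => /xy np pS; apply: np.
by rewrite -[p ∙ _](oactK g) oactVK; move: pS; rewrite oactVK; apply: fixed_act; rewrite invgK.
Qed.

(** A common fixed point [p] with [x <= p <= x ∙ h] is [x], since applying the
    inverse of [h] gives [p <= x]. *)
Lemma linked_mem S x h : S h -> ~ fixed S x -> linked S x (x ∙ h).
Proof.
move=> Sh nx p xph pS; apply: nx.
suff -> : x = p by [].
have ph := pS _ Sh; have pV := oact_fixV ph.
case/orP: xph => /andP[u v]; apply/eqP; rewrite eq_le ?u ?v ?andbT //=.
  by rewrite -(oact_le h) ph.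
by rewrite -(oact_le h) ph.
Qed.

(** The supremum of a bounded orbit is a common fixed point. *)
Lemma orbit_unbounded H y z : is_subgroup H -> linked H y z ->
  exists2 h, H h & z < y ∙ h.
Proof.
move=> [H1 HM HV] yz; apply: contrapT => nh.
have ub h : H h -> y ∙ h <= z.
  by move=> Hh; rewrite leNgt; apply/negP => zh; apply: nh; exists h.
pose O := [set y ∙ h | h in H].
have hsO : has_sup O.
  by split; [exists (y ∙ 1%g); exists 1%g | exists z => _ [h Hh <-]; exact: ub].
have le_sup h : H h -> y ∙ h <= sup O.
  by move=> Hh; apply: ub_le_sup; [case: hsO | exists h].
have yq : y <= sup O by rewrite -{1}(oact1 y); exact: le_sup.
have qz : sup O <= z by apply: ge_sup; [case: hsO | move=> _ [h Hh <-]; exact: ub].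
apply: (yz (sup O)); first by rewrite /between yq qz.
have qs s : H s -> sup O <= sup O ∙ s.
  move=> Hs; apply: ge_sup; first by case: hsO.
  by move=> _ [h Hh <-]; rewrite oact_leV -oactM; apply: le_sup; apply: HM => //; apply: HV.
move=> s Hs; apply/eqP; rewrite eq_le qs // andbT.
by have := qs _ (HV _ Hs); rewrite oact_leV invgK.
Qed.

(** As for [orbit_unbounded], but using positive powers only; the direction of
    the motion has to be known. *)
Lemma escape_up g x y : x < x ∙ g -> linked [set g] x y ->
  exists n, y < x ∙ (g ^+ n)%g.
Proof.
move=> xg /linked1P xy; apply: contrapT => nh.
have ub n : x ∙ (g ^+ n)%g <= y.
  by rewrite leNgt; apply/negP => zh; apply: nh; exists n.
pose O := range (fun n => x ∙ (g ^+ n)%g).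
have hsO : has_sup O.
  by split; [exists (x ∙ (g ^+ 0)%g); exists 0%N | exists y => _ [h _ <-]; exact: ub].
have le_sup n : x ∙ (g ^+ n)%g <= sup O.
  by apply: ub_le_sup; [case: hsO | exists n].
have xq : x <= sup O by rewrite -{1}(oact1 x); exact: (le_sup 0%N).
have qz : sup O <= y by apply: ge_sup; [case: hsO | move=> _ [h _ <-]; exact: ub].
apply: (xy (sup O)); first by rewrite /between xq qz.
apply/eqP; rewrite eq_le; apply/andP; split.
  rewrite -[in leRHS](oactVK g (sup O)) oact_le; apply: ge_sup; first by case: hsO.
  by move=> _ [n _ <-]; rewrite oact_leV invgK -oactXS.
apply: ge_sup; first by case: hsO.
move=> _ [n _ <-]; apply: (@le_trans _ _ (x ∙ (g ^+ n.+1)%g)).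
  by apply: oactX_homo => //; exact: ltW.
by rewrite oactXS oact_le.
Qed.

(** If no point in between were fixed, some iterates of one of the two points
    would pass the other one, whereas monotonicity keeps them on their side. *)
Lemma fixed_point_between g x y : x < x ∙ g -> y ∙ g < y ->
  exists2 p, between x p y & p ∙ g = p.
Proof.
move=> xg yg; apply: contrapT => np.
have lxy : linked [set g] x y by apply/linked1P => p xpy pg; apply: np; exists p.
have iter_le h u n : u ∙ h < u -> u ∙ (h ^+ n)%g <= u.
  move=> uh; elim: n => [|n IH]; first by rewrite expg0 oact1.
  by rewrite oactXS (le_trans _ (ltW uh)) // oact_le.
have [xy|yx] := leP x y.
  have [n] := escape_up xg lxy.
  by rewrite ltNge (le_trans _ (iter_le _ _ n yg)) // oact_le.
have yV : y < y ∙ g^-1%g by rewrite oact_ltV invgK.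
have xV : x ∙ g^-1%g < x by rewrite -oact_ltV.
have [|n] := escape_up (y := x) yV.
  apply/linked1P => p ypx pg; apply: np; exists p.
    by move: ypx; rewrite /between; lra.
  by rewrite -[in RHS](oactVK g p) pg.
by rewrite ltNge (le_trans _ (iter_le _ _ n xV)) // oact_le ltW.
Qed.

End Basics.

Section Opposite.
Context (R : realType) (gT : groupType) (a : order_action R gT).

(** Conjugation by [-%R] turns statements about suprema and positive motion into
    statements about infima and negative motion. *)
Definition opposite_action : order_action R gT.
Proof.
exists (fun g x => - a g (- x)).
- by move=> g h x; rewrite opprK oactM.
- by move=> x; rewrite oact1 opprK.
- by move=> g x y xy; rewrite ltrN2 oact_lt ltrN2.
Defined.

Lemma escape_down g x y : a g x < x -> linked a [set g] x y ->
  exists n, a (g ^+ n)%g x < y.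
Proof.
move=> xg /linked1P xy.
have [||n] := @escape_up _ _ opposite_action g (- x) (- y).
- by rewrite /= opprK ltrN2.
- apply/linked1P => p xpy /(congr1 (@GRing.opp _)) /=; rewrite opprK.
  by apply: xy; move: xpy; rewrite /between; lra.
- by rewrite /= opprK ltrN2; exists n.
Qed.

Lemma orbit_passes g x y : a g x <> x -> linked a [set g] x y ->
  exists f n, (f = g \/ f = g^-1%g) /\ between x y (a (f ^+ n)%g x).
Proof.
move=> xg xy.
have xyV : linked a [set g^-1%g] x y.
  move/linked1P: xy => xy; apply/linked1P => p /xy pg /oact_fixV.
  by rewrite invgK.
have gV z : z = g \/ z = g^-1%g -> linked a [set z] x y by case=> ->.
have [f fg xf] : exists2 f, f = g \/ f = g^-1%g & x < a f x.
  case: (ltgtP x (a g x)) => [lt|gt|/esym //]; first by exists g; [left|].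
  by exists g^-1%g; [right | rewrite oact_ltV invgK].
have [f' fg' xf'] : exists2 f, f = g \/ f = g^-1%g & a f x < x.
  case: (ltgtP x (a g x)) => [lt|gt|/esym //]; last by exists g; [left|].
  by exists g^-1%g; [right | rewrite -oact_ltV].
have [le_xy|lt_yx] := leP x y.
  have [n yn] := escape_up xf (gV _ fg).
  by exists f, n; split=> //; rewrite /between le_xy ltW.
have [n yn] := escape_down xf' (gV _ fg').
by exists f', n; split=> //; rewrite /between (ltW yn) (ltW lt_yx) orbT.
Qed.

End Opposite.

(** * Hoelder's theorem *)

Section Holder.
Context (R : realType) (gT : groupType) (a : order_action R gT).
Context (Q : set gT) (U : set R).
Implicit Types (x y u v w : R) (g h e q r : gT).

Local Notation "x ∙ g" := (a g x) (at level 40, left associativity).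

Hypothesis QG : is_subgroup Q.
Hypothesis U_convex : forall x p y, U x -> U y -> between x p y -> U p.
Hypothesis UQ : forall q u, Q q -> U u -> U (u ∙ q).
(* The group acts freely on U modulo the kernel of that action. *)
Hypothesis free : forall q u v, Q q -> U u -> U v -> u ∙ q = u -> v ∙ q = v.

Let QM q r : Q q -> Q r -> Q (q * r)%g.
Proof. by case: QG => _ QM _; apply: QM. Qed.
Let QV q : Q q -> Q q^-1%g.
Proof. by case: QG => _ _; apply. Qed.

Lemma free_pos q u v : Q q -> U u -> U v -> u < u ∙ q -> v < v ∙ q.
Proof.
move=> Qq Uu Uv uq; rewrite ltNge; apply/negP; rewrite le_eqVlt => /orP[/eqP vq|vq].
  by move: uq; rewrite (free Qq Uv Uu vq) ltxx.
have [p upv pq] := fixed_point_between uq vq.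
by move: uq; rewrite (free Qq (U_convex Uu Uv upv) Uu pq) ltxx.
Qed.

(** Comparing two elements of [Q] at one point of [U] compares them everywhere,
    by [free_pos] applied to their quotient: this is a bi-invariant order. *)
Lemma free_lt q r u v : Q q -> Q r -> U u -> U v -> u ∙ q < u ∙ r -> v ∙ q < v ∙ r.
Proof.
move=> Qq Qr Uu Uv; rewrite -[in X in X < _ -> _](invgK q) -oact_ltV -oactM => uqr.
rewrite -[in X in X < _](invgK q) -oact_ltV -oactM.
by apply: free_pos uqr => //; apply: QM => //; apply: QV.
Qed.

Lemma free_eq q r u v : Q q -> Q r -> U u -> U v -> u ∙ q = u ∙ r -> v ∙ q = v ∙ r.
Proof.
move=> Qq Qr Uu Uv uqr; apply/eqP; rewrite eq_le; apply/andP; split.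
  by rewrite leNgt; apply/negP => /(free_lt Qr Qq Uv Uu); rewrite uqr ltxx.
by rewrite leNgt; apply/negP => /(free_lt Qq Qr Uv Uu); rewrite uqr ltxx.
Qed.

Lemma free_le q r u v : Q q -> Q r -> U u -> U v -> u ∙ q <= u ∙ r -> v ∙ q <= v ∙ r.
Proof.
by move=> Qq Qr Uu Uv; rewrite !leNgt => /negP H; apply/negP => /(free_lt Qr Qq Uv Uu).
Qed.

Let QX q n : Q q -> Q (q ^+ n)%g.
Proof.
move=> Qq; elim: n => [|n IH]; first by rewrite expg0; case: QG.
by rewrite expgSr; apply: QM.
Qed.

Lemma free_archimedean e q u : Q e -> Q q -> U u -> u < u ∙ e -> u <= u ∙ q ->
  exists n, u ∙ (e ^+ n)%g <= u ∙ q < u ∙ (e ^+ n.+1)%g.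
Proof.
move=> Qe Qq Uu ue uq.
have ex : exists k, u ∙ q < u ∙ (e ^+ k)%g.
  apply: escape_up => //; apply/linked1P => p upq pe.
  have Up := U_convex Uu (UQ Qq Uu) upq.
  by move: ue; rewrite (free Qe Up Uu pe) ltxx.
case: (ex_minnP ex) => -[|k]; first by rewrite expg0 oact1 ltNge uq.
move=> hk mk; exists k; rewrite hk andbT leNgt; apply/negP => /mk.
by rewrite ltnn.
Qed.

(** Hoelder's argument. Otherwise the commutator [c] satisfies [c > 1] in the
    order of [free_lt]. Then no [e > 1] satisfies [e ^+ 2 <= c]: enclosing [q]
    and [r] between consecutive powers of [e] bounds the discrepancy between
    [q * r] and [r * q] by [e ^+ 2]. Any [e] strictly between 1 and [c] would
    give such a square root, as [c] is the product of [e] and [e^-1 * c], and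
    the smaller of the two has its square below [c]. Therefore [c] is the least
    positive element, [q] and [r] are powers of [c], and they commute. *)
Lemma free_commute_pos q r u : Q q -> Q r -> U u -> u <= u ∙ q -> u <= u ∙ r ->
  u ∙ q ∙ r <= u ∙ r ∙ q.
Proof.
move=> Qq Qr Uu uq ur; rewrite leNgt; apply/negP => lt_rq_qr.
pose c := ((r * q)^-1 * (q * r))%g.
have Qc : Q c by apply: QM; [apply: QV|]; apply: QM.
have cE : u ∙ r ∙ q ∙ c = u ∙ q ∙ r by rewrite /c -!oactM [in LHS]mulgA mulVKg.
have Urq : U (u ∙ r ∙ q) by apply: UQ => //; apply: UQ.
have posc v : U v -> v < v ∙ c by move=> Uv; apply: (free_pos Qc Urq Uv); rewrite cE.
have no_sqrt e : Q e -> u < u ∙ e -> u ∙ c < u ∙ e ∙ e.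
  move=> Qe ue; rewrite ltNge; apply/negP => ee_c.
  have [m /andP[m1 m2]] := free_archimedean Qe Qq Uu ue uq.
  have [n /andP[n1 n2]] := free_archimedean Qe Qr Uu ue ur.
  have h1 : u ∙ q ∙ r < u ∙ (e ^+ m.+1)%g ∙ (e ^+ n.+1)%g.
    apply: (@lt_trans _ _ (u ∙ q ∙ (e ^+ n.+1)%g)); last by rewrite oact_lt.
    by apply: free_lt n2 => //; [exact: QX | exact: UQ].
  have h2 : u ∙ (e ^+ n)%g ∙ (e ^+ m)%g <= u ∙ r ∙ q.
    apply: (@le_trans _ _ (u ∙ r ∙ (e ^+ m)%g)); first by rewrite oact_le.
    by apply: free_le m1 => //; [exact: QX | exact: UQ].
  have h3 : u ∙ (e ^+ m.+1)%g ∙ (e ^+ n.+1)%g = u ∙ (e ^+ n)%g ∙ (e ^+ m)%g ∙ e ∙ e.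
    have mulX k l : u ∙ (e ^+ k)%g ∙ (e ^+ l)%g = u ∙ (e ^+ (k + l))%g.
      by rewrite -oactM -expgnDr.
    by rewrite !mulX -!oactXS addSn addnS addnC.
  have h4 : u ∙ (e ^+ n)%g ∙ (e ^+ m)%g ∙ e ∙ e <= u ∙ r ∙ q ∙ e ∙ e.
    by rewrite !oact_le.
  have h5 : u ∙ r ∙ q ∙ e ∙ e <= u ∙ r ∙ q ∙ c.
    by rewrite -oactM; apply: (@free_le _ _ u) => //; [exact: QM | rewrite oactM].
  by move: h1; rewrite h3 ltNge (le_trans h4) // (le_trans h5) // cE.
have no_between e : Q e -> u < u ∙ e -> u ∙ c <= u ∙ e.
  move=> Qe ue; rewrite leNgt; apply/negP => ec.
  pose e' := (e^-1 * c)%g.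
  have Qe' : Q e' by apply: QM => //; apply: QV.
  have ee' : u ∙ e ∙ e' = u ∙ c by rewrite -oactM /e' mulgA mulgV mul1g.
  have Ue := UQ Qe Uu.
  have ue' : u < u ∙ e' by apply: (free_pos Qe' Ue Uu); rewrite ee'.
  have [ee|ee] := leP (u ∙ e) (u ∙ e').
    have := no_sqrt _ Qe ue; rewrite ltNge => /negP; apply.
    by rewrite -ee'; apply: free_le ee.
  have := no_sqrt _ Qe' ue'; rewrite ltNge => /negP; apply.
  by rewrite -ee' oact_le ltW.
have powc s : Q s -> u <= u ∙ s -> exists n, u ∙ s = u ∙ (c ^+ n)%g.
  move=> Qs us; have [n /andP[n1 n2]] := free_archimedean Qc Qs Uu (posc _ Uu) us.
  exists n; apply/eqP; rewrite eq_le n1 andbT leNgt; apply/negP => lt_ns.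
  have Qe : Q (s * (c ^+ n)^-1)%g by apply: QM => //; apply: QV; apply: QX.
  have := no_between _ Qe; rewrite oactM oact_ltV invgK => /(_ lt_ns).
  by rewrite leNgt -oact_ltV -oactM -expgS n2.
have [m qm] := powc _ Qq uq; have [n rn] := powc _ Qr ur.
have qm' := free_eq Qq (QX m Qc) Uu (UQ Qr Uu) qm.
have rn' := free_eq Qr (QX n Qc) Uu (UQ Qq Uu) rn.
by move: lt_rq_qr; rewrite qm' rn' qm rn -!oactM -!expgnDr addnC ltxx.
Qed.

Lemma holder q r u : Q q -> Q r -> U u -> u ∙ q ∙ r = u ∙ r ∙ q.
Proof.
move=> Qq Qr Uu.
pose C s t := forall v, U v -> v ∙ s ∙ t = v ∙ t ∙ s.
have CV s t : Q s -> Q t -> C s t -> C s^-1%g t.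
  move=> Qs Qt st v Uv; apply: (@oact_inj _ _ a s).
  by rewrite oactVK -st ?oactVK //; apply: UQ => //; apply: QV.
have Q1 : Q 1%g by case: QG.
have posC s t : Q s -> Q t -> u <= u ∙ s -> u <= u ∙ t -> C s t.
  move=> Qs Qt us ut v Uv.
  have pos w g : Q g -> U w -> u <= u ∙ g -> w <= w ∙ g.
    move=> Qg Uw; rewrite -{1}(oact1 a u) -{1}(oact1 a w).
    exact: free_le.
  by apply/eqP; rewrite eq_le !free_commute_pos // pos.
have sgn s : Q s -> u <= u ∙ s \/ u <= u ∙ s^-1%g.
  move=> Qs; have [|us] := leP u (u ∙ s); [by left | right].
  by rewrite ltW // oact_ltV invgK.
have CC s t : C s t -> C t s by move=> st v Uv; rewrite st.
case: (sgn _ Qq) => uq; case: (sgn _ Qr) => ur.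
- exact: posC.
- apply: (CC) => //; rewrite -(invgK r); apply: (CV); [exact: QV| by []|].
  by apply: posC => //; apply: QV.
- rewrite -(invgK q); apply: (CV) => //; [exact: QV|].
  by apply: posC => //; apply: QV.
- rewrite -(invgK q); apply: (CV) => //; [exact: QV|].
  apply: (CC); rewrite -(invgK r); apply: (CV); [exact: QV|exact: QV|].
  by apply: posC => //; apply: QV.
Qed.
End Holder.

(** * Actions whose elements have finitely many components of support *)

(** Phrased with sequences, which is how the property is contradicted: a
    sequence of moved points, any two of them separated by a fixed point,
    would meet infinitely many components. *)
Definition finite_bumps (R : realType) (gT : groupType) (a : order_action R gT) :=
  forall (g : gT) (v : nat -> R), (forall n, a g (v n) <> v n) ->
  exists i j, (i < j)%N /\ linked a [set g] (v i) (v j).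

Section Commuting.
Context (R : realType) (gT : groupType) (a : order_action R gT).
Implicit Types (x y p : R) (g h : gT) (H K : set gT).

Local Notation "x ∙ g" := (a g x) (at level 40, left associativity).

Hypothesis finite_bumps_a : finite_bumps a.

Lemma not_fixed H x : ~ fixed a H x -> exists2 h, H h & x ∙ h <> x.
Proof.
by move=> nx; apply: contrapT => nh; apply: nx => s Hs; apply: contrapT => xs; apply: nh; exists s.
Qed.

(** Orbits of cyclic groups are monotone sequences. *)
Lemma oactX_between g x i j : (i < j)%N ->
  between (x ∙ (g ^+ i)%g) (x ∙ (g ^+ i.+1)%g) (x ∙ (g ^+ j)%g).
Proof.
move=> ij; have [xg|gx] := leP x (x ∙ g).
  have := oactX_homo xg (ltnW (ltnSn i)); have := oactX_homo xg ij.
  by rewrite /between; lra.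
have xg : - x <= opposite_action a g (- x) by rewrite /= opprK lerN2 ltW.
have := oactX_homo xg (ltnW (ltnSn i)); have := oactX_homo xg ij.
by rewrite /= opprK /between; lra.
Qed.

Lemma fixed_commute H g x n : (forall h, H h -> commute h g) ->
  fixed a H x -> fixed a H (x ∙ (g ^+ n)%g).
Proof.
by move=> Hg xH h Hh; rewrite -oactM -(commuteX n (Hg _ Hh)) oactM xH.
Qed.

(** If [g] moved the block of [x] off itself, the points [x ∙ g ^+ n] would lie
    in distinct blocks of [H], and an element of [H] moving [x] would move all
    of them since it commutes with [g]. *)
Lemma linked_commute H g x : (forall h, H h -> commute h g) ->
  ~ fixed a H x -> linked a H x (x ∙ g).
Proof.
move=> Hg nx; have [h Hh xh] := not_fixed nx.
apply: contrapT => /not_linked[p xpg pH].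
have [|i [j [ij /linked1P]]] := @finite_bumps_a h (fun n => x ∙ (g ^+ n)%g).
  by move=> n; rewrite -oactM -(commuteX n (Hg _ Hh)) oactM => /oact_inj.
apply; last exact: (fixed_commute i Hg pH).
move: xpg; rewrite -(between_act a _ _ _ (g ^+ i)%g).
rewrite -(oactM a x) -expgS.
by have := oactX_between g x ij; rewrite /between; lra.
Qed.

(** The orbits of [p] and [y] under [H] reach arbitrarily far into the block, so
    alternating translates of the fixed point [p] and of a moved point [y]
    would produce infinitely many components of the support of [g]. *)
Lemma fixes_block H g x y p : is_subgroup H -> (forall h, H h -> commute h g) ->
  linked a H x p -> linked a H x y -> p ∙ g = p -> y ∙ g = y.
Proof.
move=> HG Hg xp xy pg; apply: contrapT => yg.
have [H1 _ _] := HG.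
have yp0 := linked_trans (linked_sym xy) xp.
have [h0 Hh0 lt_yp] := orbit_unbounded HG (linked_sym yp0).
have {x xp xy yp0 pg} [q lt_yq [yq qg]] : exists2 q, y < q & linked a H y q /\ q ∙ g = q.
  exists (p ∙ h0) => //; split.
    by apply: linked_trans yp0 (linked_mem Hh0 (linked_nfixed (linked_sym yp0))).
  by rewrite -oactM (Hg _ Hh0) oactM pg.
(* Build h_0, h_1, ... in H with y.h_n < q.h_n < y.h_(n+1). *)
have next h : exists h', H h -> H h' /\ q ∙ h < y ∙ h'.
  have [Hh|nHh] := pselect (H h); last by exists h.
  have yqh : linked a H y (q ∙ h).
    exact: linked_trans yq (linked_mem Hh (linked_nfixed (linked_sym yq))).
  by have [h' Hh' lt] := orbit_unbounded HG yqh; exists h'.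
have [f fP] := choice next.
pose s n := iter n f 1%g.
have Hs n : H (s n) by elim: n => [|n IH] //=; have [] := fP _ IH.
have [|i [j [ij /linked1P]]] := @finite_bumps_a g (fun n => y ∙ s n).
  by move=> n; rewrite -oactM (Hg _ (Hs n)) oactM => /oact_inj.
move=> /(_ (q ∙ s i)); apply; last by rewrite -oactM (Hg _ (Hs i)) oactM qg.
have lt_ys n : y ∙ s n < q ∙ s n by rewrite oact_lt.
have lt_qs n : q ∙ s n < y ∙ s n.+1 by have [] := fP _ (Hs n).
have mono : nondecreasing_seq (fun n => y ∙ s n).
  by apply/nondecreasing_seqP => n; rewrite ltW // (lt_trans (lt_ys n)).
by rewrite /between (ltW (lt_ys i)) (le_trans (ltW (lt_qs i))) // mono.
Qed.

(** On a block of [H] the group [K] satisfies the hypotheses of Hoelder's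
    theorem, by [linked_commute] and [fixes_block]; so its commutators are
    trivial on every block of [H]. *)
Lemma commuting_supports H K x k k' : is_subgroup H -> is_subgroup K ->
  (forall h, H h -> forall k, K k -> commute h k) -> K k -> K k' ->
  x ∙ [~ k, k']%g <> x -> fixed a H x.
Proof.
move=> HG KG HK Kk Kk' xkk'; apply: contrapT => nx; apply: xkk'.
have HKg g : K g -> forall h, H h -> commute h g by move=> Kg h Hh; apply: HK.
have xx : linked a H x x by exact: linked_refl.
have -> : x ∙ [~ k, k']%g = x ∙ (k' * k)^-1%g ∙ k ∙ k'.
  by rewrite -!oactM commgEl conjgE invgM !mulgA.
have [_ KM KV] := KG.
rewrite (@holder _ _ a K (linked a H x)) //.
- by rewrite -oactM -oactM mulVg oact1.
- move=> u p v xu xv upv; apply: (linked_trans xu).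
  exact: linked_sub upv (linked_trans (linked_sym xu) xv).
- move=> g u Kg xu; apply: (linked_trans xu).
  apply: linked_commute; first exact: HKg.
  exact: linked_nfixed (linked_sym xu).
- move=> g u v Kg xu xv; exact: fixes_block HG (HKg _ Kg) xu xv.
- apply: linked_commute => //; apply: HKg; apply: KV; exact: KM.
Qed.

End Commuting.

(** * Elements of bounded support *)

Section Supports.
Context (R : realType) (gT : groupType) (a : order_action R gT).
Implicit Types (x y p b c : R) (g h k : gT) (C : set R) (N : set gT).

Local Notation "x ∙ g" := (a g x) (at level 40, left associativity).

Definition supported h b c := forall x, (x <= b) || (c <= x) -> x ∙ h = x.

Lemma supportedW h b c b' c' : b' <= b -> c <= c' ->
  supported h b c -> supported h b' c'.
Proof. by move=> bb cc hs x xbc; apply: hs; lra. Qed.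

Lemma supportedV h b c : supported h b c -> supported h^-1%g b c.
Proof. by move=> hs x /hs /oact_fixV. Qed.

Lemma supportedM h k b c : supported h b c -> supported k b c ->
  supported (h * k)%g b c.
Proof. by move=> hs ks x xbc; rewrite oactM hs // ks. Qed.

Lemma supportedJ h g b c : supported h b c -> supported (h ^ g)%g (b ∙ g) (c ∙ g).
Proof.
move=> hs x xbc; rewrite -{1}(oactVK a g x) oactJ hs ?oactVK //.
by rewrite -[_ <= b]oact_leV -(oact_le a g c) oactVK.
Qed.

Lemma supportedR h k b c : supported h b c -> supported k b c ->
  supported [~ h, k]%g b c.
Proof.
move=> hs ks; rewrite commgEl conjgE.
by do ?apply: supportedM => //; apply: supportedV.
Qed.

Lemma supported_moved h b c x : supported h b c -> x ∙ h <> x -> b < x < c.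
Proof.
move=> hs hx; apply: contrapT => nx; apply: hx; apply: hs.
by apply/negPn/negP => nx'; apply: nx; lra.
Qed.

Lemma moved_exists h : faithful a -> h <> 1%g -> exists x, x ∙ h <> x.
Proof.
move=> fa h1; apply: contrapT => nx; apply: h1; apply: fa => x.
by apply: contrapT => xh; apply: nx; exists x.
Qed.

Lemma commute_supported h k b c b' c' : faithful a ->
  supported h b c -> supported k b' c' -> c <= b' -> commute h k.
Proof.
move=> fa hs ks cb; apply: (faithful_eq fa) => x; rewrite !oactM.
have hc : c ∙ h = c by apply: hs; rewrite lexx orbT.
have kb : b' ∙ k = b' by apply: ks; rewrite lexx.
have [xc|cx] := leP x c.
  have xb : x <= b' := le_trans xc cb.
  have xhb : x ∙ h <= b' by apply: le_trans cb; rewrite -hc oact_le.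
  by rewrite (ks x) ?xb // ks ?xhb.
suff cxk : c <= x ∙ k by rewrite (hs x) ?(ltW cx) ?orbT // hs // cxk orbT.
have [xb|bx] := leP x b'; first by rewrite ks ?xb // ltW.
by apply: le_trans cb _; rewrite -kb oact_le ltW.
Qed.

(** For a component [C] of a support, the ends of [C] may be infinite; asking for
    a support in a segment of [C] treats all cases alike. *)
Definition local_group C : set gT :=
  [set h | exists b c, [/\ C b, C c & supported h b c]].

(** The condition [b <= c] has content: the bounds that witness a membership in
    [local_group] may come in the wrong order, for the identity. *)
Lemma local_group2 C h k : local_group C h -> local_group C k ->
  exists b c, [/\ C b, C c, b <= c, supported h b c & supported k b c].
Proof.
move=> [b [c [Cb Cc hs]]] [b' [c' [Cb' Cc' ks]]].
exists (Num.min (Num.min b b') (Num.min c c')), (Num.max (Num.max b b') (Num.max c c')).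
split; first by rewrite /Num.min; do ?case: ifP.
- by rewrite /Num.max; do ?case: ifP.
- by rewrite !(ge_min, le_max) lexx.
- by apply: supportedW hs; rewrite !(ge_min, le_max) lexx ?orbT.
- by apply: supportedW ks; rewrite !(ge_min, le_max) lexx ?orbT.
Qed.

Lemma local_group_subgroup C c : C c -> is_subgroup (local_group C).
Proof.
move=> Cc; split.
- by exists c, c; split => // x _; rewrite oact1.
- move=> h k Hh Hk; have [b [d [Cb Cd _ hs ks]]] := local_group2 Hh Hk.
  by exists b, d; split => //; apply: supportedM.
- by move=> h [b [d [Cb Cd hs]]]; exists b, d; split => //; apply: supportedV.
Qed.

Lemma local_group_commute C D h k : faithful a ->
  (forall x p y, C x -> C y -> between x p y -> C p) ->
  (forall x p y, D x -> D y -> between x p y -> D p) ->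
  (forall x, C x -> ~ D x) ->
  local_group C h -> local_group D k -> commute h k.
Proof.
move=> fa cC cD CD Hh Hk.
have [b [c [Cb Cc bc hs _]]] := local_group2 Hh Hh.
have [b' [c' [Db Dc bc' ks _]]] := local_group2 Hk Hk.
have [cb|bc1] := leP c b'; first exact: commute_supported hs ks cb.
have [cb|bc2] := leP c' b; first by apply/commute_sym; exact: commute_supported ks hs cb.
have [bb|bb] := leP b b'.
  by case: (CD b') => //; apply: cC Cb Cc _; rewrite /between; lra.
by case: (CD b) => //; apply: cD Db Dc _; rewrite /between; lra.
Qed.

(** The classical trick of Higman: the commutator of [k] and [n] lies in [N]
    and, because [k ^ n] commutes with [k] and [k'], its commutator with [k'] is
    that of [k^-1]. *)
Lemma commutator_displaced N k k' n : is_subgroup N ->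
  N n -> N (n ^ k)%g -> (forall m, N m -> N (m ^ k')%g) ->
  commute (k ^ n)%g k -> commute (k ^ n)%g k' ->
  N [~ k^-1, k']%g.
Proof.
move=> [_ NM NV] Nn Nnk Nk' ckk ckk'.
pose m := [~ k, n]%g.
have Nm : N m by rewrite /m commgEr conjVg; apply: NM => //; apply: NV.
suff -> : [~ k^-1, k']%g = [~ m, k']%g.
  by rewrite commgEl; apply: NM; [apply: NV | apply: Nk'].
have fixk' : ((k ^ n) ^ k')%g = (k ^ n)%g by rewrite conjgE ckk' mulKg.
have c1 : commute (k ^ n)%g [~ k^-1, k']%g.
  rewrite commgEl conjgE; apply: commuteM; first by rewrite invgK.
  apply: commuteM; first exact: commuteV.
  by apply: commuteM => //; apply: commuteV.
rewrite [RHS]commgEl /m [in RHS]commgEl conjMg fixk' invgM invgK.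
by apply: (@mulgI _ (k ^ n)%g); rewrite c1 commgEl invgK !mulgA mulgV mul1g.
Qed.


End Supports.

(** * Compressing segments in a coherent action *)

Section Coherent.
Context (R : realType) (gT : groupType) (a : order_action R gT).
Implicit Types (x y p b c : R) (f g h k : gT) (C : set R) (N : set gT).

Local Notation "x ∙ g" := (a g x) (at level 40, left associativity).

Hypothesis faithful_a : faithful a.
Hypothesis dense_orbits : forall x b c, b < c -> exists g, b < x ∙ g < c.
Hypothesis right_mover : exists f,
  (exists r, forall x, x < r -> x ∙ f = x) /\
  (exists r, forall x, r < x -> x ∙ f <> x).
Hypothesis left_mover : exists f,
  (exists r, forall x, r < x -> x ∙ f = x) /\ (exists x, x ∙ f <> x).

Definition expander f b c :=
  (forall x, x <= b -> x ∙ f = x) /\ forall z, exists n, z < c ∙ (f ^+ n)%g.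

Lemma expanderJ f g b c : expander f b c -> expander (f ^ g)%g (b ∙ g) (c ∙ g).
Proof.
move=> [fb fc]; split=> [x|z].
  by rewrite oact_leV => xb; rewrite -{1}(oactVK a g x) oactJ fb ?oactVK.
have [n] := fc (z ∙ g^-1%g); rewrite -oact_ltV => nz.
by exists n; rewrite -conjXg oactJ.
Qed.

Lemma expanderW f b c b' c' : b' <= b -> c <= c' ->
  expander f b c -> expander f b' c'.
Proof.
move=> bb cc [fb fc]; split=> [x xb|z]; first by rewrite fb // (le_trans xb).
by have [n nz] := fc z; exists n; rewrite (lt_le_trans nz) // oact_le.
Qed.

Lemma expander_pull f b c z : expander f b c ->
  exists n, z ∙ (f ^+ n)^-1%g < c.
Proof. by move=> [_ /(_ z)[n nz]]; exists n; rewrite -oact_ltV. Qed.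

Lemma expander_fix f b c n x : expander f b c -> x <= b -> x ∙ (f ^+ n)%g = x.
Proof. by move=> [fb _] xb; apply: oact_fixX; apply: fb. Qed.

Lemma some_expander : exists f b c, expander f b c.
Proof.
have [f0 [[r fr] [s fs]]] := right_mover.
pose x := s + 1.
have [f [fr' fs' xf]] : exists f, [/\ forall x, x < r -> x ∙ f = x,
    forall x, s < x -> x ∙ f <> x & x < x ∙ f].
  have [xf|xf] := ltP x (x ∙ f0); first by exists f0.
  exists f0^-1%g; split=> [y /fr /oact_fixV //|y /fs ys yV|].
    by apply: ys; rewrite -[y in LHS]yV oactVK.
  rewrite oact_ltV invgK lt_neqAle xf andbT; apply/eqP.
  by apply: fs; rewrite /x; lra.
exists f, (r - 1), x; split=> [y yr|z]; first by apply: fr'; lra.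
have [xz|zx] := leP x z; last by exists 0%N; rewrite expg0 oact1.
apply: escape_up => //; apply/linked1P => p xpz; apply: fs'.
by move: xpz xz; rewrite /between /x; lra.
Qed.

(** The infimum [t] of the points whose orbits are unbounded above: it is fixed,
    as that set of points is invariant. Inverse powers of [f] then bring any
    point beyond [t] arbitrarily close to [t]. *)
Lemma source_point : exists f t, t ∙ f = t /\
  forall y z, t < y -> exists n, z < y ∙ (f ^+ n)%g.
Proof.
have [f [b [c fE]]] := some_expander; have [_ fc] := fE.
pose P := [set y | forall z, exists n, z < y ∙ (f ^+ n)%g].
have Pc : P c by exact: fc.
have lbP : lbound P b.
  move=> y Py; rewrite leNgt; apply/negP => yb; have [n] := Py b.
  by rewrite (expander_fix n fE) ?ltW // ltNge ltW.
have hlP : has_lbound P by exists b.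
have PV y : P y -> P (y ∙ f^-1%g).
  move=> Py z; have [n nz] := Py z; exists n.+1.
  by rewrite expgS oactM oactVK.
have Pf y : P y -> P (y ∙ f).
  move=> Py z; have [n nz] := Py (z ∙ f^-1%g); exists n.
  by rewrite -oactM -expgS oactXS oact_ltV.
exists f, (inf P); split.
  apply/eqP; rewrite eq_le; apply/andP; split.
    apply: lb_le_inf; first by exists c.
    move=> y /PV /(ge_inf hlP).
    by rewrite oact_leV invgK.
  rewrite oact_leV; apply: lb_le_inf; first by exists c.
  by move=> y /Pf /(ge_inf hlP); rewrite oact_leV.
move=> y z /inf_lt[|w Pw wy]; first by exists c.
by have [n nz] := Pw z; exists n; rewrite (lt_trans nz) // oact_lt.
Qed.

(** By minimality, conjugate so that the source point [t] of [source_point] is on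
    the left of [p]; inverse powers compress the segment towards [t], and
    minimality moves [t], with a small neighbourhood, into the target. *)
Lemma contract_segment p q b c : p <= q -> b < c -> exists g, b < p ∙ g /\ q ∙ g < c.
Proof.
move=> pq bc; have [f [t [tf ft]]] := source_point.
have pp : p - 1 < p by lra.
have [h /andP[_ thp]] := dense_orbits t pp.
have [k /andP[btk tkc]] := dense_orbits (t ∙ h) bc.
have ty : t < c ∙ k^-1%g ∙ h^-1%g by rewrite !oact_ltV !invgK.
have [n nq] := ft _ (q ∙ h^-1%g) ty.
have qn : q ∙ ((f ^+ n)^-1 ^ h)%g ∙ k < c.
  rewrite -(oact_lt a k^-1%g) oactK -(oact_lt a h^-1%g).
  by rewrite -[q](oactVK a h) oactJ oactK -oact_ltV.
exists ((f ^+ n)^-1 ^ h * k)%g; rewrite !(oactM a _ _ k); split=> //.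
apply: lt_trans btk _; rewrite oact_lt.
have th : t ∙ h ∙ ((f ^+ n)^-1 ^ h)%g = t ∙ h.
  by rewrite oactJ; congr (_ ∙ _); rewrite oact_fixV // oact_fixX.
by rewrite -th oact_lt.
Qed.

Lemma expander_exists b c : b < c -> exists f, expander f b c.
Proof.
move=> bc; have [f [b0 [c0 fE]]] := some_expander.
have bc0 : b0 <= c0.
  rewrite leNgt; apply/negP => cb; have [_ /(_ c0)[n]] := fE.
  by rewrite (expander_fix n fE) ?ltxx // ltW.
have [g [bg cg]] := contract_segment bc0 bc.
by exists (f ^ g)%g; apply: expanderW (expanderJ g fE); apply: ltW.
Qed.

(** Compress everything into the left target, then push the right segment
    beyond its target by an expander supported on the right of the left segment,
    and finally pull it back into the target by the inverse of an expander
    located inside that target, which does not affect the left segment. *)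
Lemma contract_pair p x y q p1 p2 q1 q2 : p <= x -> x < y -> y <= q ->
  p1 < p2 -> p2 <= q1 -> q1 < q2 ->
  exists g, [/\ p1 < p ∙ g, x ∙ g < p2, q1 < y ∙ g & q ∙ g < q2].
Proof.
move=> px xy yq p12 pq q12.
have [g [pg qg]] := contract_segment (le_trans px (le_trans (ltW xy) yq)) p12.
have xyg : x ∙ g < y ∙ g by rewrite oact_lt.
have [f fE] := expander_exists xyg.
pose m1 := (2 * q1 + q2) / 3; pose m2 := (q1 + 2 * q2) / 3.
have m12 : m1 < m2 by rewrite /m1 /m2; lra.
have qm1 : q1 < m1 by rewrite /m1; lra.
have qm2 : m2 < q2 by rewrite /m2; lra.
have [_ /(_ m1)[n nm1]] := fE.
have [f' fE'] := expander_exists m12.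
have [l lm2] := expander_pull (q ∙ g ∙ (f ^+ n)%g) fE'.
have fix' z : z <= m1 -> z ∙ (f' ^+ l)^-1%g = z.
  by move=> zm; rewrite oact_fixV // (expander_fix _ fE').
have yg : y ∙ g <= q ∙ g by rewrite oact_le.
have pxg : p ∙ g <= x ∙ g by rewrite oact_le.
have low z : z <= x ∙ g -> z ∙ (f ^+ n)%g ∙ (f' ^+ l)^-1%g = z.
  by move=> zx; rewrite (expander_fix n fE zx) fix' //; lra.
exists (g * f ^+ n * (f' ^+ l)^-1)%g.
rewrite !oactM (low (p ∙ g)) // (low (x ∙ g)) ?lexx //.
split=> //; first by lra.
  by apply: lt_trans qm1 _; rewrite -(fix' m1) ?lexx // oact_lt.
by lra.
Qed.
(** The commutator of a map trivial near -oo with a map trivial near +oo is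
    trivial near both ends. Here the first map [F] pushes a point [u] moved by
    the second map [f2] outside of the support of [f2], so they do not commute. *)
Lemma bounded_element : exists k b c x, supported a k b c /\ x < x ∙ k.
Proof.
have [f2 [[s fs] [u uf2]]] := left_mover.
have uu : u - 1 < u by lra.
have [f fE] := expander_exists uu; have [_ /(_ s)[n sn]] := fE.
pose F := (f ^+ n)%g.
have Flow x : x <= u - 1 -> x ∙ F = x by exact: expander_fix fE.
pose k := [~ F, f2]%g.
have kE x : x ∙ k = x ∙ F^-1%g ∙ f2^-1%g ∙ F ∙ f2.
  by rewrite -!oactM /k commgEl conjgE !mulgA.
have vk : u ∙ f2 ∙ F ∙ k <> u ∙ f2 ∙ F.
  rewrite kE oactK oactK (fs _ sn) => /oact_inj uf; apply: uf2.
  by rewrite -uf.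
have [b [c ksupp]] : exists b c, supported a k b c.
  exists (Num.min (u - 1) ((u - 1) ∙ f2)), (Num.max (s + 1) ((s + 1) ∙ F)).
  move=> x /orP[|]; rewrite kE ?le_min ?ge_max => /andP[h1 h2].
    rewrite (oact_fixV (Flow _ h1)) (Flow (x ∙ f2^-1%g)) ?oactVK //.
    by rewrite -oact_leV.
  have h3 : s < x ∙ F^-1%g.
    by rewrite oact_ltV invgK; apply: lt_le_trans h2; rewrite oact_lt; lra.
  by rewrite (oact_fixV (fs _ h3)) oactVK fs //; lra.
have [vv|vv] := ltP (u ∙ f2 ∙ F) (u ∙ f2 ∙ F ∙ k).
  by exists k, b, c, (u ∙ f2 ∙ F).
exists k^-1%g, b, c, (u ∙ f2 ∙ F); split; first exact: supportedV.
rewrite oact_ltV invgK lt_neqAle vv andbT; exact/eqP.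
Qed.

(** A conjugate [k'] of [k] supported between [x] and [x ∙ k] is displaced by [k],
    hence does not commute with it; a further conjugation brings both supports
    into the target. *)
Lemma noncommuting_pair b c : b < c -> exists k k' b' c',
  [/\ b < b', c' < c, supported a k b' c', supported a k' b' c' & ~ commute k k'].
Proof.
move=> bc; have [k [b0 [c0 [x [ks xk]]]]] := bounded_element.
have /andP[b0x xc0] : b0 < x < c0.
  by apply: (supported_moved ks) => xkx; move: xk; rewrite xkx ltxx.
have [g [xb0 c0x]] := contract_segment (ltW (lt_trans b0x xc0)) xk.
pose k' := (k ^ g)%g.
have k's : supported a k' (b0 ∙ g) (c0 ∙ g) by exact: supportedJ.
have ncom : ~ commute k k'.
  move=> ckk'; suff : x ∙ g ∙ k' = x ∙ g.
    by rewrite oactJ => /oact_inj xkx; move: xk; rewrite xkx ltxx.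
  have {1}-> : k' = (k' ^ k)%g by rewrite conjgE -ckk' mulKg.
  apply: (supportedJ k's); apply/orP; left.
  have : x ∙ k < b0 ∙ g ∙ k by rewrite oact_lt.
  have : x ∙ g < c0 ∙ g by rewrite oact_lt.
  lra.
pose m := Num.min b0 (b0 ∙ g); pose M := Num.max c0 (c0 ∙ g).
have mM : m <= M by rewrite ge_min le_max (ltW (lt_trans b0x xc0)).
have [h [mh Mh]] := contract_segment mM bc.
exists (k ^ h)%g, (k' ^ h)%g, (m ∙ h), (M ∙ h); split=> //.
- by apply: supportedJ; apply: supportedW ks; rewrite ?ge_min ?le_max lexx.
- by apply: supportedJ; apply: supportedW k's; rewrite ?ge_min ?le_max lexx orbT.
- by rewrite /commute -!conjMg => /conjg_inj.
Qed.

(** * The group of a component of support *)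

Section Region.
Context (C : set R).
Hypothesis C_convex : forall x p y, C x -> C y -> between x p y -> C p.
Hypothesis C_open : forall x, C x -> exists2 y, C y & x < y.

(** Take [k] of bounded support with [x < x ∙ k]. Conjugate it so that the lower
    part of its support, up to [x], lies in the target and [x ∙ k] lies beyond
    the segment: the inverse of the conjugate does what is required. *)
Lemma push_into u1 u2 w1 w2 : C u1 -> C w2 -> u1 < u2 -> u2 <= w1 -> w1 <= w2 ->
  exists s, [/\ local_group a C s, u1 < w1 ∙ s & w2 ∙ s < u2].
Proof.
move=> Cu1 Cw2 u12 uw w12; have [q Cq wq] := C_open Cw2.
have [k [b [c [x [ks xk]]]]] := bounded_element.
have nx : x ∙ k <> x by move=> xkx; move: xk; rewrite xkx ltxx.
have /andP[bx _] := supported_moved ks nx.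
have /andP[_ xc] : b < x ∙ k < c.
  by apply: (supported_moved ks) => /oact_inj.
have [g [ubg xgu wxg cgq]] :=
  contract_pair (ltW bx) xk (ltW xc) u12 (le_trans uw w12) wq.
have kgs := supportedJ (g := g) ks.
have bxg : b ∙ g < x ∙ g by rewrite oact_lt.
have xcg : x ∙ k ∙ g < c ∙ g by rewrite oact_lt.
exists (k ^ g)^-1%g; split.
- exists (b ∙ g), (c ∙ g); split; last exact: supportedV.
  + by apply: C_convex Cu1 Cq _; rewrite /between; lra.
  + by apply: C_convex Cu1 Cq _; rewrite /between; lra.
- apply: lt_trans ubg _; rewrite oact_ltV invgK kgs ?lexx //; lra.
- by rewrite -oact_ltV; apply: lt_trans wxg _; rewrite -oactJ oact_lt.
Qed.

(** An element of [N] that displaces a small segment is conjugated, by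
    [push_into], into one that displaces a segment containing the supports of
    [k] and [k']; then [commutator_displaced] applies. *)
Lemma commutators_in_normal N : is_subgroup N ->
  (forall n h, N n -> local_group a C h -> N (n ^ h)%g) ->
  (forall w, C w -> exists n u1 u2,
    [/\ N n, C u1, u1 < u2, u2 <= w & u2 <= u1 ∙ n]) ->
  forall k k', local_group a C k -> local_group a C k' -> N [~ k, k']%g.
Proof.
move=> NG NJ Nsmall k k' Hk Hk'.
have [w1 [w2 [Cw1 Cw2 w12 ks ks']]] := local_group2 Hk Hk'.
have [n [u1 [u2 [Nn Cu1 u12 uw uun]]]] := Nsmall _ Cw1.
have [s [Hs us su]] := push_into Cu1 Cw2 u12 uw w12.
have [H1 HM HV] := local_group_subgroup a Cw1.
have HkV := HV _ Hk.
pose m := (n ^ s^-1)%g.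
have nE : n = (m ^ s)%g by rewrite conjgKV.
have w2m : w2 <= w1 ∙ m.
  rewrite -(oact_le a s) -oactJ -nE ltW // (lt_le_trans su) // (le_trans uun) //.
  by rewrite oact_le ltW.
have Nm : N m by apply: NJ => //; apply: HV.
have mcom t t' : supported a t w1 w2 -> supported a t' w1 w2 -> commute (t ^ m)%g t'.
  move=> ts ts'; apply/commute_sym.
  exact: (commute_supported faithful_a ts' (supportedJ ts)).
rewrite -[k]invgK; apply: (@commutator_displaced _ N k^-1%g k' m) => //.
- by apply: NJ.
- by move=> l Nl; apply: NJ.
- by apply: mcom; apply: supportedV.
- by apply: mcom => //; apply: supportedV.
Qed.

(** Take a nontrivial commutator supported strictly between [c ∙ g] and [c]; its
    conjugate by [g] has a disjoint support, hence differs from it. *)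
Lemma noncentral_commutator c g : C c -> C (c ∙ g) -> c ∙ g < c ->
  exists k k', [/\ local_group a C k, local_group a C k' &
                   ~ commute [~ k, k']%g g].
Proof.
move=> Cc Ccg cgc.
have [k [k' [b' [c' [cb cc ks ks' nkk']]]]] := noncommuting_pair cgc.
have bc' : b' < c'.
  rewrite ltNge; apply/negP => cb'; apply: nkk'.
  exact: (commute_supported faithful_a ks ks').
have Cb' : C b' by apply: C_convex Cc Ccg _; rewrite /between; lra.
have Cc' : C c' by apply: C_convex Cc Ccg _; rewrite /between; lra.
exists k, k'; split; [by exists b', c' | by exists b', c' |] => ckk'.
apply: nkk'; apply/commgP/eqP; set m := [~ k, k']%g in ckk' *.
have ms : supported a m b' c' by exact: supportedR.
have msg := supportedJ (g := g) ms.
have mg : (m ^ g)%g = m by rewrite conjgE ckk' mulKg.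
apply: contrapT => /(moved_exists faithful_a)[x xm].
have /andP[bx xc] := supported_moved ms xm.
have := @supported_moved _ _ a _ _ _ x msg; rewrite mg => /(_ xm).
have : c' ∙ g < c ∙ g by rewrite oact_lt.
lra.
Qed.

End Region.

End Coherent.

(** * The coherent action against an action with finite supports *)

Section Obstruction.
Context (R : realType) (gT : groupType) (a s : order_action R gT).
Implicit Types (x y p v c : R) (f g h k : gT).

Hypothesis a_faithful : faithful a.
Hypothesis a_dense : forall x b c, b < c -> exists g, b < a g x < c.
Hypothesis a_right_mover : exists f,
  (exists r, forall x, x < r -> a f x = x) /\
  (exists r, forall x, r < x -> a f x <> x).
Hypothesis a_left_mover : exists f,
  (exists r, forall x, r < x -> a f x = x) /\ (exists x, a f x <> x).
Hypothesis s_faithful : faithful s.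
Hypothesis s_bumps : finite_bumps s.

(** The component of the support of [g] containing [c], when [g] moves [c]. *)
Definition bump g c := linked a [set g] c.

Local Notation H g c := (local_group a (bump g c)).

Lemma bump_convex g c x p y : bump g c x -> bump g c y -> between x p y -> bump g c p.
Proof.
move=> cx cy xpy; apply: (linked_trans cx).
exact: linked_sub xpy (linked_trans (linked_sym cx) cy).
Qed.

Lemma bump_moved g c x : bump g c x -> a g x <> x.
Proof. by move=> /linked_sym/linked1P; apply; rewrite /between lexx; lra. Qed.

Lemma bump_act g c x : bump g c x -> bump g c (a g x).
Proof.
move=> cx; apply: (linked_trans cx); apply: linked_mem => //.
exact: linked_nfixed (linked_sym cx).
Qed.

Lemma bumpV g c : bump g^-1%g c = bump g c.
Proof.
apply: funext => x; apply: propext; split=> /linked1P cx; apply/linked1P => p /cx pg.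
  by move/oact_fixV.
by move/oact_fixV; rewrite invgK.
Qed.

Lemma bump_actV g c x : bump g c x -> bump g c (a g^-1%g x).
Proof. by rewrite -bumpV => /bump_act. Qed.

Lemma bump_open g c x : bump g c x -> exists2 y, bump g c y & x < y.
Proof.
move=> cx; case: (ltgtP x (a g x)) => [lt|gt|/esym /(bump_moved cx) //].
  by exists (a g x) => //; exact: bump_act.
by exists (a g^-1%g x); [exact: bump_actV | rewrite oact_ltV invgK].
Qed.

Lemma bump_refl g c : a g c <> c -> bump g c c.
Proof. by move=> cg; apply: linked_refl => /(_ g erefl). Qed.

Lemma bump_down g c x : a g c < c -> bump g c x -> a g x < x.
Proof.
move=> cg cx; rewrite ltNge; apply/negP; rewrite le_eqVlt.
case/orP=> [/eqP/esym|xg]; first exact: bump_moved cx.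
have [p xpc pg] := fixed_point_between xg cg.
by move/linked1P: (linked_sym cx) => /(_ p xpc).
Qed.

Lemma local_groupJ (C : set R) g h : (forall x, C x -> C (a g x)) ->
  local_group a C h -> local_group a C (h ^ g)%g.
Proof.
move=> Cg [b [c [Cb Cc hs]]]; exists (a g b), (a g c).
by split; [exact: Cg | exact: Cg | exact: supportedJ].
Qed.

Lemma linkedX S v g n : (forall h, S h -> S (h ^ g)%g) ->
  linked s S v (s g v) -> linked s S v (s (g ^+ n)%g v).
Proof.
move=> Sg vg; elim: n => [|n IH]; last first.
  by rewrite oactXS; apply: (linked_trans vg); apply: linked_act.
by rewrite expg0 oact1; apply: linked_refl; apply: linked_nfixed vg.
Qed.

(** The blocks of [H g c] in the second action that are met by commutators are
    [g]-invariant. Otherwise the images of the block of [v] under powers of [g]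
    are pairwise distinct, and each [h] moves points in finitely many of them
    only; so [h ^ (g ^+ n)] acts trivially on the block of [v] for some
    arbitrarily large [n]. In the first action these conjugates displace segments
    that converge to the lower end of [bump g c], whence the kernel [N] of the
    action on the block contains all commutators. *)
Lemma commutator_block_down g c v k k' : a g c < c ->
  H g c k -> H g c k' -> s [~ k, k']%g v <> v -> linked s (H g c) v (s g v).
Proof.
move=> cg Hk Hk' vkk'; apply: contrapT => nvg; apply: (vkk').
have Cc : bump g c c by apply: bump_refl => cgc; move: cg; rewrite cgc ltxx.
have HG := local_group_subgroup a Cc; have [H1 HM HV] := HG.
have HJ h h' : H g c h -> H g c h' -> H g c (h ^ h')%g.
  by move=> Hh Hh'; rewrite conjgE; apply: (HM); [exact: HV | exact: HM].
have Hg h : H g c h -> H g c (h ^ g)%g by apply: local_groupJ => x; exact: bump_act.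
have HX n h : H g c h -> H g c (h ^ (g ^+ n))%g.
  move=> Hh; elim: n => [|n IH]; first by rewrite expg0 conjg1.
  by rewrite expgSr conjgM; apply: Hg.
have HXV n h : H g c h -> H g c (h ^ (g ^+ n)^-1)%g.
  move=> Hh; elim: n => [|n IH]; first by rewrite expg0 invg1 conjg1.
  rewrite expgS invgM conjgM; move: IH; apply: local_groupJ => x; exact: bump_actV.
have nv : ~ fixed s (H g c) v.
  move=> vH; apply: vkk'; apply: vH; rewrite commgEl.
  by apply: HM; [exact: HV | exact: HJ].
pose N := [set h | H g c h /\ forall e, linked s (H g c) v e -> s h e = e].
suff [_] : N [~ k, k']%g by apply; exact: linked_refl.
apply: (commutators_in_normal a_faithful a_dense a_right_mover a_left_mover
  (C := bump g c)) => //.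
- exact: bump_convex.
- exact: bump_open.
- split=> [|h h' [Hh hN] [Hh' hN']|h [Hh hN]].
  + by split=> // e _; rewrite oact1.
  + by split; [apply: (HM) | move=> e ve; rewrite oactM hN // hN'].
  + by split; [exact: HV | move=> e ve; rewrite oact_fixV // hN].
- move=> n h [Hn nN] Hh; split=> [|e ve]; first exact: HJ.
  rewrite -{1}(oactVK s h e) oactJ nN ?oactVK //.
  apply: (linked_trans ve); apply: linked_mem; first exact: HV.
  exact: linked_nfixed (linked_sym ve).
move=> w Cw.
(* Some h moves u1 up to u2; its conjugates by g ^+ n displace the segment
   [u1, u2].g^n, which lies below w for n large. *)
have [h [u1 [u2 [Hh Cu1 Cu2 u12 hu]]]] : exists h u1 u2,
    [/\ H g c h, bump g c u1, bump g c u2, u1 < u2 & a h u1 = u2].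
  have [h0 [b [d [x [hs xh]]]]] :=
    bounded_element a_dense a_right_mover a_left_mover.
  have /andP[bx xd] : b < x < d.
    by apply: (supported_moved hs) => hx; move: xh; rewrite hx ltxx.
  have /andP[_ hxd] : b < a h0 x < d.
    by apply: (supported_moved hs) => /oact_inj hx; move: xh; rewrite hx ltxx.
  have [f [cf fc]] := contract_segment a_dense a_right_mover (ltW (lt_trans bx xd)) cg.
  have C_in p : b <= p <= d -> bump g c (a f p).
    move=> /andP[bp pd]; apply: bump_convex (bump_act Cc) Cc _.
    have : a f b <= a f p by rewrite oact_le.
    have : a f p <= a f d by rewrite oact_le.
    by rewrite /between; lra.
  exists (h0 ^ f)%g, (a f x), (a f (a h0 x)); split.
  - exists (a f b), (a f d); split; [apply: C_in; lra | apply: C_in; lra |].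
    exact: supportedJ.
  - by apply: C_in; lra.
  - by apply: C_in; lra.
  - by rewrite oact_lt.
  - by rewrite oactJ.
have u2g := bump_down cg Cu2.
have u2w : linked a [set g] u2 w := linked_trans (linked_sym Cu2) Cw.
have [n0 n0w] := escape_down u2g u2w.
have CX n x : bump g c x -> bump g c (a (g ^+ n)%g x).
  move=> Cx; elim: n => [|n IH]; first by rewrite expg0 oact1.
  by rewrite oactXS; exact: bump_act.
have down n : a (g ^+ (n0 + n))%g u2 < w.
  elim: n => [|n IH]; first by rewrite addn0.
  by rewrite addnS oactXS (lt_trans _ IH) // (bump_down cg) //; exact: CX.
suff [n nN] : exists n, N (h ^ (g ^+ (n0 + n)))%g.
  exists (h ^ (g ^+ (n0 + n)))%g, (a (g ^+ (n0 + n))%g u1), (a (g ^+ (n0 + n))%g u2).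
  split=> //; [exact: CX | by rewrite oact_lt | by rewrite ltW |].
  by rewrite oactJ hu.
apply: contrapT => nN.
have next n : exists e, linked s (H g c) v e /\
    s (h ^ (g ^+ (n0 + n)))%g e <> e.
  apply: contrapT => ne; apply: nN; exists n; split=> [|e ve]; first exact: HX.
  by apply: contrapT => he; apply: ne; exists e.
have [e eP] := choice next.
(* If no conjugate were trivial on the block, h would move a point in the
   image of the block by g^-(n0 + n), for all n. *)
have [|i [j [ij vij]]] := @s_bumps h (fun n => s (g ^+ (n0 + n))^-1%g (e n)).
  move=> n hfix; have [_] := eP n; apply.
  by rewrite -{1}(oactVK s (g ^+ (n0 + n))%g (e n)) oactJ hfix oactVK.
have eV n : linked s (H g c) (s (g ^+ (n0 + n))^-1%g v) (s (g ^+ (n0 + n))^-1%g (e n)).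
  by apply: linked_act; [exact: HXV | have [] := eP n].
have vV : linked s (H g c) (s (g ^+ (n0 + i))^-1%g v) (s (g ^+ (n0 + j))^-1%g v).
  apply: (linked_trans (eV i)); apply: linked_trans (linked_sym (eV j)).
  by move=> p /vij ph pH; apply: ph => _ ->; apply: pH.
have := linked_act (HX (n0 + j)%N) vV; rewrite oactVK -oactM.
have -> : ((g ^+ (n0 + i))^-1 * g ^+ (n0 + j) = g ^+ (j - i))%g.
  by rewrite -{1}(subnKC (ltnW ij)) addnA (expgnDr g (n0 + i)) mulKg.
move=> vji; apply: nvg; apply: linked_sub (linked_sym vji).
have ji : (0 < j - i)%N by rewrite subn_gt0.
by have := oactX_between s g v ji; rewrite expg0 oact1 expg1.
Qed.

Lemma commutator_block g c v k k' : a g c <> c ->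
  H g c k -> H g c k' -> s [~ k, k']%g v <> v -> linked s (H g c) v (s g v).
Proof.
case: (ltgtP c (a g c)) => [gc _|cg _|/esym //]; last exact: commutator_block_down cg.
have gcV : a g^-1%g c < c by rewrite -oact_ltV.
have := @commutator_block_down _ _ v k k' gcV; rewrite bumpV => + Hk Hk' vkk'.
move=> /(_ Hk Hk' vkk') /(@linked_act _ _ _ _ g); rewrite oactVK => vg.
apply: linked_sym; apply: vg => h; apply: local_groupJ => x; exact: bump_act.
Qed.

(** If [g] fixed every point moved by a commutator, the supports would be disjoint
    and [g] would commute with it, against [noncentral_commutator]. *)
Lemma bump_commutator_meets g c : a g c <> c ->
  exists v k k', [/\ H g c k, H g c k', s [~ k, k']%g v <> v & s g v <> v].
Proof.
move=> gc.
have [k [k' [Hk Hk' nc]]] : exists k k', [/\ H g c k, H g c k' &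
    ~ commute [~ k, k']%g g].
  have nc f d : bump f d = bump g c -> a f d < d -> exists k k',
      [/\ H g c k, H g c k' & ~ commute [~ k, k']%g f].
    move=> fd dd; rewrite -fd.
    have Cd : bump f d d by apply: bump_refl => dd'; move: dd; rewrite dd' ltxx.
    apply: (noncentral_commutator a_faithful a_dense a_right_mover a_left_mover
      (C := bump f d) _ _ _ dd) => //; [exact: bump_convex | exact: bump_act].
  case: (ltgtP c (a g c)) => [lt|lt|/esym //]; last exact: nc.
  have [||k [k' [Hk Hk' nkk']]] := nc g^-1%g c.
  - exact: bumpV.
  - by rewrite -oact_ltV.
  exists k, k'; split=> // ckg; apply: nkk'; exact: commuteV.
suff [v [vk gv]] : exists v, s [~ k, k']%g v <> v /\ s g v <> v.
  by exists v, k, k'.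
apply: contrapT => nv; apply: nc; apply: (faithful_eq s_faithful) => x.
rewrite (oactM s x [~ k, k']%g) (oactM s x g).
have fixed_by y : s [~ k, k']%g y <> y -> s g y = y.
  by move=> ky; apply: contrapT => gy; apply: nv; exists y.
have [kx|kx] := pselect (s [~ k, k']%g x = x).
  rewrite kx; have [kgx //|kgx] := pselect (s [~ k, k']%g (s g x) = s g x).
  by have /oact_inj gx := fixed_by _ kgx; move: kgx; rewrite gx kx.
by rewrite (fixed_by _ kx) fixed_by // => /oact_inj.
Qed.

Lemma no_finite_bump_action g (c : nat -> R) : (forall n, a g (c n) <> c n) ->
  (forall i j, (i < j)%N -> ~ linked a [set g] (c i) (c j)) -> False.
Proof.
move=> gc cij.
have [v vP] := choice (fun n => bump_commutator_meets (gc n)).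
have [n|i [j [ij vij]]] := @s_bumps g v; first by have [k [k' []]] := vP n.
have [k [k' [Hk Hk' vkk' gv]]] := vP i.
have [l [l' [Hl Hl' vll' _]]] := vP j.
have Hi := local_group_subgroup a (bump_refl (gc i)).
have Hj := local_group_subgroup a (bump_refl (gc j)).
have vj_fixed : fixed s (H g (c i)) (v j).
  apply: (commuting_supports s_bumps Hi Hj) Hl Hl' vll' => h Hh h' Hh'.
  apply: (local_group_commute a_faithful) Hh Hh'; try exact: bump_convex.
  by move=> x ix jx; apply: (cij _ _ ij); apply: linked_trans ix (linked_sym jx).
have vg := commutator_block (gc i) Hk Hk' vkk'.
have Hg h : H g (c i) h -> H g (c i) (h ^ g)%g.
  by apply: local_groupJ => x; exact: bump_act.
have HgV h : H g (c i) h -> H g (c i) (h ^ g^-1)%g.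
  by apply: local_groupJ => x; exact: bump_actV.
have vgV : linked s (H g (c i)) (v i) (s g^-1%g (v i)).
  by apply: linked_sym; have := linked_act HgV vg; rewrite oactK.
have [f [n [fg vjn]]] := orbit_passes gv vij.
suff /(_ _ vjn) : linked s (H g (c i)) (v i) (s (f ^+ n)%g (v i)) by [].
by case: fg => ->; apply: linkedX.
Qed.

End Obstruction.

(** * Thompson's group acting on the line *)

Section ThompsonAction.
Context (R : realType).
Implicit Types (f g : homeo (unit_interval R)) (x y : R) (u : ThompsonF R).

Definition extend f x : R :=
  if (insub x : option (unit_interval R)) is Some c then val (f c) else x.

Lemma extend_val f (c : unit_interval R) : extend f (val c) = val (f c).
Proof. by rewrite /extend valK. Qed.

Lemma extend_out f x : ~~ (0 <= x <= 1) -> extend f x = x.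
Proof.
move=> nx; rewrite /extend; case: insubP => // c _ cx.
by move: nx; rewrite -cx unit_interval_bounds.
Qed.

Lemma unit_intervalP x : (exists c : unit_interval R, val c = x) \/ ~~ (0 <= x <= 1).
Proof.
have [x01|nx] := boolP (0 <= x <= 1); last by right.
by left; exists (mk_unit_interval x01).
Qed.

Lemma extendM f g x : extend (f * g)%g x = extend g (extend f x).
Proof.
have [[c <-]|nx] := unit_intervalP x; first by rewrite !extend_val.
by rewrite !(extend_out _ nx).
Qed.

Lemma extend1 x : extend 1%g x = x.
Proof.
have [[c <-]|nx] := unit_intervalP x; first by rewrite extend_val.
by rewrite extend_out.
Qed.

Lemma extend_homo f : {homo f : x y / val x < val y} -> {homo extend f : x y / x < y}.
Proof.
move=> fi x y; have [[c <-]|nx] := unit_intervalP x;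
  have [[d <-]|ny] := unit_intervalP y; rewrite ?extend_val ?(extend_out _ nx) ?(extend_out _ ny).
- exact: fi.
- have := unit_interval_bounds c; have := unit_interval_bounds (f c); lra.
- have := unit_interval_bounds d; have := unit_interval_bounds (f d); lra.
- by [].
Qed.

Lemma thompsonP u : thompson_set (val u).
Proof. exact: set_mem (valP u). Qed.

Definition thompson_action : order_action R (ThompsonF R).
Proof.
exists (fun u x => extend (val u) x).
- by move=> u v x; rewrite -extendM.
- by move=> x; exact: extend1.
- by move=> u; apply: extend_homo; case: (thompsonP u).
Defined.

Lemma thompson_faithful : faithful thompson_action.
Proof.
move=> u u1; apply: val_inj; apply: homeo_eq => c.
apply: val_inj; rewrite -extend_val; exact: u1.
Qed.

Lemma pigeonhole (T : finType) (h : nat -> T) : exists i j, (i < j)%N /\ h i = h j.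
Proof.
have /injectivePn[i [j ij hij]] : ~~ injectiveb (fun i : 'I_#|T|.+1 => h i).
  by apply/injectiveP => /leq_card; rewrite card_ord ltnn.
by case: (ltngtP i j) => [lt|lt|/val_inj eq]; [exists i, j | exists j, i | case/eqP: ij].
Qed.

(** Two points of the sequence lie in the same interval between breakpoints, and
    are displaced in the same direction, by the pigeonhole principle. On that
    interval the displacement is an affine function, of the same strict sign at
    both points, hence without zero in between. *)
Lemma thompson_finite_bumps : finite_bumps thompson_action.
Proof.
move=> u v uv.
have [fi [s [_ sP]]] := thompsonP u; set f := val u in fi sP.
have in01 n : exists c : unit_interval R, val c = v n.
  by have [//|nv] := unit_intervalP (v n); have := uv n; rewrite /= extend_out.
have bnd n : (count (fun b => (b < v n)%R) s < (size s).+1)%N.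
  by rewrite ltnS count_size.
(* The interval of v n is encoded by the number of breakpoints below v n. *)
have [i [j [ij [cij sij]]]] :=
  pigeonhole (fun n => (Ordinal (bnd n), thompson_action u (v n) < v n)).
exists i, j; split=> //.
have key k l : v k < v l -> count (fun b => (b < v k)%R) s = count (fun b => (b < v l)%R) s ->
    (thompson_action u (v k) < v k) = (thompson_action u (v l) < v l) ->
    linked thompson_action [set u] (v k) (v l).
  move=> kl ckl skl.
  have [c cE] := in01 k; have [d dE] := in01 l.
  have [||e [b fE]] := sP c d; first by rewrite cE dE.
    move=> x xs; apply/negP; rewrite cE dE => /andP[kx xl].
    have := @count_lt _ (fun b => (b < v k)%R) (fun b => (b < v l)%R) s x.
    rewrite ckl ltnn => H; suff : false by []; apply: H => //; last by rewrite -leNgt ltW.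
    by move=> y yk; apply: lt_trans yk kl.
  apply/linked1P => p kpl.
  have [m mE] : exists m : unit_interval R, val m = p.
    have [//|] := unit_intervalP p; have := unit_interval_bounds c.
    have := unit_interval_bounds d; rewrite cE dE.
    by move: kpl; rewrite /between; lra.
  have fm : val (f m) = 2 ^ e * p + b.
    by rewrite fE mE // cE dE; move: kpl; rewrite /between; lra.
  have fc : val (f c) = 2 ^ e * v k + b by rewrite fE cE ?dE ?lexx ?ltW.
  have fd : val (f d) = 2 ^ e * v l + b by rewrite fE dE ?cE ?lexx ?ltW.
  rewrite /= -mE extend_val -/f fm mE => pfix.
  have := uv k; have := uv l; move: skl.
  rewrite /= -cE -dE !extend_val -/f fc fd cE dE.
  move: pfix kpl; rewrite /between; move: (2 ^ e) => q pfix kpl sgn_kl vl vk.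
  have {}kpl : v k <= p <= v l by move: kpl; lra.
  have bE : b = p - q * p by move: pfix; lra.
  have dE' z : (q * z + b < z) = ((q - 1) * (z - p) < 0).
    by rewrite bE -subr_lt0; congr (_ < 0); ring.
  have nE z : q * z + b <> z -> (q - 1) * (z - p) != 0.
    by move=> nz; apply/eqP => z0; apply: nz; rewrite bE; move: z0; lra.
  move: sgn_kl (nE _ vk) (nE _ vl); rewrite !dE' => sgn_kl nk nl.
  have : (q - 1) * (v k - p) * ((q - 1) * (v l - p)) <= 0.
    have -> : (q - 1) * (v k - p) * ((q - 1) * (v l - p)) =
              (q - 1) ^+ 2 * ((v k - p) * (v l - p)) by ring.
    by apply: mulr_ge0_le0; [exact: sqr_ge0 | apply: mulr_le0_ge0; lra].
  case: (ltP ((q - 1) * (v k - p)) 0) sgn_kl => [k0 /esym l0|k0 /esym/negbT].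
    by rewrite leNgt nmulr_rgt0 // l0.
  rewrite -leNgt => l0; rewrite leNgt mulr_gt0 // lt_neqAle eq_sym.
    by rewrite nk.
  by rewrite nl.
have [?|?|vij] := ltgtP (v i) (v j); first exact: key.
  by apply: linked_sym; apply: key.
by rewrite vij; apply: linked_refl => /(_ u erefl); exact: uv.
Qed.

End ThompsonAction.

(** * Reduction of the theorem to order-preserving actions *)

Section Pullback.
Context (R : realType) (gT hT : groupType) (phi : {multiplicative gT -> hT}).
Context (a : order_action R hT).

Lemma multiplicative1 : phi 1%g = 1%g.
Proof. by apply: (@mulgI _ (phi 1%g)); rewrite -gmulfM !mulg1. Qed.

Definition pullback : order_action R gT.
Proof.
exists (fun g => a (phi g)).
- by move=> g h x; rewrite gmulfM oactM.
- by move=> x; rewrite multiplicative1 oact1.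
- by move=> g x y xy; rewrite oact_lt.
Defined.

Lemma pullback_faithful : injective phi -> faithful a -> faithful pullback.
Proof. by move=> inj_phi fa g /fa phig; apply: inj_phi; rewrite multiplicative1. Qed.

Lemma pullback_finite_bumps : finite_bumps a -> finite_bumps pullback.
Proof.
move=> fb g v /fb[i [j [ij /linked1P vij]]].
by exists i, j; split=> //; apply/linked1P.
Qed.

End Pullback.

Section GivenAction.
Context (R : realType) (G : subgroup (HomeoPlus R)).

Definition given_action : order_action R G.
Proof.
by refine (@OrderAction R G (fun (g : G) x => x ⋅ val g) _ _ _) => // g x y; exact: act_lt.
Defined.

Lemma given_faithful : faithful given_action.
Proof.
move=> g g1; apply: val_inj; apply: val_inj; apply: homeo_eq => x.
exact: g1.
Qed.

Lemma separated_moved_points (g : G) :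
  infinite_set (components_of_support (val g)) ->
  exists2 c : nat -> R, forall n, given_action g (c n) <> c n &
    forall i j, (i < j)%N -> ~ linked given_action [set g] (c i) (c j).
Proof.
move=> /infiniteP/pcard_leP/unsquash F.
have /choice[c cP] : forall n, exists x, Defs.support (val g) x /\
    @connected_component R (Defs.support (val g)) x = F n.
  by move=> n; have [x sx xF] := @funS _ _ _ _ F n I; exists x.
exists c => [n|i j ij /linked1P cij].
  by have [/eqP] := cP n.
(* Points not separated by a fixed point of g span a connected part of the
   support, so they are in the same component. *)
have : F i = F j.
  rewrite -(cP i).2 -(cP j).2; apply: same_connected_component.
  have := @connected_component_max R (Defs.support (val g))
    [set p | between (c i) p (c j)] (c i).
  apply; [by rewrite /= /between lexx; lra | by move=> p /cij /eqP | | ].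
    by apply/connected_intervalP => x y; rewrite /= /between => xB yB z; lra.
  by rewrite /= /between lexx; lra.
move=> /inj; rewrite !inE => /(_ I I) eij; move: ij; rewrite eij ltnn.
by [].
Qed.

Lemma given_dense : minimal_action G -> forall x b c, b < c ->
  exists g, b < given_action g x < c.
Proof.
move=> minG x b c bc; have [||y [/= ybc [g _ gy]]] := minG x [set` `]b, c[].
- by exists ((b + c) / 2); rewrite /= in_itv /=; lra.
- exact: interval_open.
by exists g; move: ybc; rewrite in_itv /= -gy.
Qed.

End GivenAction.

Theorem theorem1p9 (R : realType) (G : subgroup (HomeoPlus R)) :
  finitely_generated G ->
  coherent G ->
  (exists g : G, infinite_set (components_of_support (val g))) ->
  ~ embeds G (ThompsonF R).
Proof.
move=> _ [minG _ [f [fr [r fmoves]]] [f' [f'l [r' f'moves]]]] [g ginf] [phi phi_inj].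
have [c gc cij] := separated_moved_points ginf.
apply: (@no_finite_bump_action R G (given_action G)
  (pullback phi (thompson_action R)) _ _ _ _ _ _ g c gc cij).
- exact: given_faithful.
- exact: given_dense.
- by exists f; split=> //; exists r => x /fmoves /eqP.
- by exists f'; split=> //; exists (r' - 1); apply/eqP/f'moves; lra.
- exact: pullback_faithful phi_inj (@thompson_faithful R).
- exact/pullback_finite_bumps/thompson_finite_bumps.
Qed.
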